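(* Let $X^m$ be an orthant space and let the stratum $\sigma=\mathcal{O}(E)$ of co-dimension $l$ $(\ge2)$ bound, in $X^m$, the stratum $\tau=\mathcal{O}(E\cup F)$ of co-dimension $l'$ $(<l-1)$. Fix $x,x^*\in X^m$ with $x^*\in\sigma$. Then, as a function of $w_\tau\in\mathcal{S}^{l-l'}_{\tau\setminus\sigma}$, the directional derivative $D$ of $\Psi_\tau(x,w_\tau;x^* )$ at $w_\tau$ in the direction $v\in\mathcal{T}_{w_\tau}(\mathcal{S}^{l-l'}_{\tau\setminus\sigma})$ exists and satisfies $$\langle w_\tau,\,D\Psi_\tau(x,w_\tau;x^* )(v)\rangle=0.$$
   Context: Orthant spaces. Let $U=(u_1,\dots,u_M)$ be the standard orthonormal basis of $\mathbb{R}^M$. For $E\subseteq U$, $\mathbb{R}(E)$ is the span of $E$ and $\mathcal{O}(E)=\{\sum_{e\in E}\lambda_e e:\lambda_e>0\}$ is an open positive orthant ($\mathcal{O}(\emptyset)=\{o\}$, $o$ the origin). An orthant space $X^m$ of dimension $m\le M$ is a subspace of $\mathbb{R}^M$ that is a union of open positive orthants (its strata) of maximum dimension $m$, with the intrinsic (length) metric $d$ induced from the Euclidean metric, such that (a) for every orthant $\sigma$ in $X^m$ the orthants in its closure are also in $X^m$; (b) if all the 2-dimensional orthants in the closure of a positive orthant $\sigma$ of $\mathbb{R}^M$ are in $X^m$ then $\sigma$ is in $X^m$. $X^m$ is a CAT(0)-space, so any two points are joined by a unique geodesic. $\mathcal{O}(E)$ bounds $\mathcal{O}(G)$ if $E\subseteq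 G$; in $E\cup F$ the sets $E,F$ are disjoint. The co-dimension of $\mathcal{O}(E)$ is $m-|E|$. Logarithm map and limits. For $x^*\in\sigma=\mathcal{O}(E)$ the tangent cone to $X^m$ at $x^*$ is the union of $\mathbb{R}(E)\times\overline{\mathcal{O}(F)}$ over $F$ disjoint from $E$ with $\mathcal{O}(E\cup F)\subseteq X^m$, glued along common faces and regarded in $\mathbb{R}^M$. $\log_{x^*}(x)$ is the initial (one-sided) tangent vector, of norm $d(x^*,x)$, of the geodesic from $x^*$ to $x$; $\Phi(x;x^* )=\log_{x^*}(x)+x^*$. For $w_\tau\in\mathbb{R}(E)\times\mathcal{O}(F)$, $\Psi(x,w_\tau;x^* )=\lim_{\lambda\to0+}\Phi(x;x^*+\lambda w_\tau)$ (which exists), and $\Psi_\tau(x,w_\tau;x^* )$ is its orthogonal projection onto $\mathbb{R}(E\cup F)$. $\mathcal{S}^{l-l'}_{\tau\setminus\sigma}$ is the set of unit vectors in $\{\mathbf0\}\times\mathcal{O}(F)\subset\mathbb{R}(E)\times\mathcal{O}(F)$, an open piece of a Euclidean unit sphere, and $\mathcal{T}_{w_\tau}(\mathcal{S}^{l-l'}_{\tau\setminus\sigma})$ is its tangent space at $w_\tau$. The directional derivative at $w_\tau$ in the direction $v$ is the one-sided derivative at $s=0+$ along the great-circle arc in $\mathcal{S}^{l-l'}_{\tau\setminus\sigma}$ starting at $w_\tau$ with initial velocity $v$ (for $\|v\|=1$, $\alpha(s)=w_\tau\cos s+v\sin s$). $\langle\cdot,\cdot\rangle$ is the Euclidean inner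 product on $\mathbb{R}(E\cup F)$. *)

(* Defs.v *)
From HB Require Import structures.
From mathcomp Require Import all_boot all_order all_algebra.
From mathcomp Require Import all_classical all_reals all_analysis.
Set Implicit Arguments.
Unset Strict Implicit.
Unset Printing Implicit Defensive.
Import Order.TTheory GRing.Theory Num.Theory.
Import numFieldNormedType.Exports.
Local Open Scope classical_set_scope.
Local Open Scope ring_scope.

(* R^M is 'rV[R]_M and a subset of its standard basis is a set of indices.
   The library norm on 'rV[R]_M is the sup norm: it only supplies the (usual)
   topology, and all metric notions use the Euclidean [dot] and [enorm]. *)
Section Orthants.
Context {R : realType} {M : nat}.
Implicit Types (E F G : {set 'I_M}) (u v w x y p : 'rV[R]_M).
Implicit Types (X : set 'rV[R]_M) (g : R -> 'rV[R]_M).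

Definition dot u v : R := \sum_(i < M) u 0 i * v 0 i.

Definition enorm u : R := Num.sqrt (dot u u).

Definition coord_span E : set 'rV[R]_M :=
  [set x | forall i, i \notin E -> x 0 i = 0].

Definition proj_span E x : 'rV[R]_M := \sum_(i in E) x 0 i *: delta_mx 0 i.

Definition orthant E : set 'rV[R]_M :=
  [set x | coord_span E x /\ forall i, i \in E -> 0 < x 0 i].

(* In the last clause the condition is vacuous when #|E| <= 1, so that X
   contains the origin and the M coordinate half-axes. *)
Definition orthant_space (m : nat) X : Prop :=
  [/\ exists C : {set {set 'I_M}}, X = \bigcup_(E in [set` C]) orthant E,
      (exists2 E, orthant E `<=` X & #|E| = m) /\
        (forall E, orthant E `<=` X -> (#|E| <= m)%N),
      forall E G, orthant E `<=` X ->
        orthant G `<=` closure (orthant E) -> orthant G `<=` X &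
      forall E, (forall G, #|G| = 2%N ->
          orthant G `<=` closure (orthant E) -> orthant G `<=` X) ->
        orthant E `<=` X].

(* Codimension of the stratum [orthant E] in a space of dimension m; the
   truncated subtraction is exact since #|E| <= m for every stratum. *)
Definition codim (m : nat) E : nat := (m - #|E|)%N.

Definition path_in X x y : set (R -> 'rV[R]_M) :=
  [set g : R -> 'rV[R]_M | [/\ {within `[0, 1], continuous g}, g 0 = x, g 1 = y &
               forall t : R, t \in `[0, 1] -> X (g t)]].

(* Length of the polygon inscribed in g at the points a :: s. *)
Definition polygon_length g (a b : R) (s : seq R) : R :=
  let F := fun n => g (nth b (a :: s) n) in
  \sum_(0 <= n < size s) enorm (F n.+1 - F n).

Definition path_length g : \bar R :=
  ereal_sup [set (polygon_length g 0 1 s)%:E | s in itv_partition 0 1].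

(* Intrinsic metric of X (finite between any two points of an orthant space). *)
Definition idist X x y : R :=
  fine (ereal_inf [set path_length g | g in path_in X x y]).

(* Geodesics are parametrised on [0, 1] proportionally to arc length; the
   values of g outside [0, 1] are irrelevant. *)
Definition geodesic X x y : set (R -> 'rV[R]_M) :=
  [set g : R -> 'rV[R]_M | [/\ g 0 = x, g 1 = y, forall t : R, t \in `[0, 1] -> X (g t) &
     forall s t : R, s \in `[0, 1] -> t \in `[0, 1] ->
       idist X (g s) (g t) = `|s - t| * idist X x y]].

(* Initial tangent vector of the geodesic from p to x, in the ambient R^M. By
   the choice of parametrisation its norm is [idist X p x]. The choice operator
   [get] is harmless as geodesics are unique on [0, 1] (X is CAT(0)). *)
Definition log_map X p x : 'rV[R]_M :=
  let g := get (geodesic X p x) in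
  lim ((fun t : R => t^-1 *: (g t - p)) @ 0^'+).

Definition Phi X x p : 'rV[R]_M := log_map X p x + p.

Definition Psi X x w p : 'rV[R]_M :=
  lim ((fun t : R => Phi X x (p + t *: w)) @ 0^'+).

(* The component Psi_tau of Psi, for tau = orthant (E :|: F). *)
Definition Psi_stratum X E F x w p : 'rV[R]_M :=
  proj_span (E :|: F) (Psi X x w p).

(* For tau = orthant (E :|: F) and sigma = orthant E: the unit vectors of
   {0} x orthant F, where R(E) x R(F) = R(E :|: F) is seen inside R^M. *)
Definition link_sphere F : set 'rV[R]_M :=
  [set w | orthant F w /\ enorm w = 1].

Definition link_tangent F w : set 'rV[R]_M :=
  [set v | coord_span F v /\ dot w v = 0].

(* Great-circle arc with initial point w and initial velocity v, of any norm;
   it is constant when v = 0. *)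
Definition great_circle w v (s : R) : 'rV[R]_M :=
  cos (enorm v * s) *: w + sin (enorm v * s) *: ((enorm v)^-1 *: v).

Definition arc_quotient (f : 'rV[R]_M -> 'rV[R]_M) w v (s : R) : 'rV[R]_M :=
  s^-1 *: (f (great_circle w v s) - f w).

Definition arc_derivable (f : 'rV[R]_M -> 'rV[R]_M) w v : Prop :=
  cvg (arc_quotient f w v @ 0^'+).

Definition arc_derive (f : 'rV[R]_M -> 'rV[R]_M) w v : 'rV[R]_M :=
  lim (arc_quotient f w v @ 0^'+).

End Orthants.

(* Main.v *)
(* A point with non-negative coordinates is in X iff the orthants of any two
   elements of its support are in X. Hence along a path from p to x the
   coordinate i of p that x lacks must vanish before any coordinate j that x
   gains and that is incompatible with i appears; these are the only
   constraints. With vanishing times 1 / (1 + a_i) and appearance times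
   d_j / (1 + d_j) this gives
     d(p, x)^2 = |x - p|^2 + min (sum p_i^2 a_i + sum x_j^2 d_j)
   over a, d >= 0 with a_i d_j >= 1 for incompatible i, j. The minimiser is
   unique, the geodesic is linear in each coordinate up to its vanishing time,
   and log_p(x) has coordinates - (1 + a_i) p_i, or x_i - p_i if both are non-zero.

   Let p = xs + t w and t -> 0. The coordinates of Psi_tau in E tend to a limit
   independent of w, and a coordinate i in F tends to x_i, to 0, or to
   - w_i a_i(w), where a(w) solves the same kind of program for the link.
   As a_i(w)^2 is a maximum of minima of finitely many ratios of sums of squares,
   it has one-sided derivatives along the arc. Finally, at the minimiser both
   parts of the cost are equal, so that sum w_i^2 a_i is half of the minimum V(w);
   differentiating this and comparing with the envelope formula
   V' = sum 2 w_i v_i a_i gives sum w_i (w_i a_i)' = 0. *)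

Require Import Defs.
From HB Require Import structures.
From mathcomp Require Import all_boot all_order all_algebra.
From mathcomp Require Import all_classical all_reals all_analysis.
From mathcomp Require Import ring lra.
Import Order.TTheory GRing.Theory Num.Theory.
Import numFieldNormedType.Exports.
Local Open Scope classical_set_scope.
Local Open Scope ring_scope.
Set Implicit Arguments.
Unset Strict Implicit.
Unset Printing Implicit Defensive.

(** The metric part rests on polygons with adjacent consecutive vertices. [polygon_action] turns
    such a polygon into a feasible pair [a, d] and bounds its action plus a penalty for the
    deviation of one intermediate point. Without the penalty this is the lower bound for distances.
    With it, it is a rigidity statement: [log_map] takes whatever geodesic [get] returns, and that
    geodesic has to agree with the optimal schedule near its start, which is all that the initial
    vector sees. The obstacle in the link is that [a(w)] is only piecewise smooth, since the
    combinatorial type of the minimiser may change along the arc. The max-min formula is an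
    expression in the weights alone. It therefore gives uniqueness of the minimiser, its limit as t
    -> 0 even though the weights of the coordinates in F degenerate to 0, and one-sided derivatives
    inherited from those of the ratios. The envelope formula comes from testing the optimal schedule
    of one direction against the weights of another, in both orders. *)

Lemma cvg_sumr {K : numFieldType} {V : normedModType K} {T I : Type}
    (F : set_system T) {FF : Filter F} (r : seq I) (P : pred I) (f : I -> T -> V) (l : I -> V) :
  (forall i, P i -> f i x @[x --> F] --> l i) ->
  \sum_(i <- r | P i) f i x @[x --> F] --> \sum_(i <- r | P i) l i.
Proof. by move=> fl; apply: cvg_big fl; exact: add_continuous. Qed.

(** * Scheduling programs *)

Section Program.
Context {R : realType} {n : nat}.
Implicit Types (W Y a d : 'I_n -> R) (e : rel 'I_n).

Definition feasible e a d :=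
  [/\ forall i, 0 <= a i, forall j, 0 <= d j &
      forall i j, e i j -> 1 <= a i * d j].

Definition cost W Y a d := \sum_i W i * a i + \sum_j Y j * d j.

(** Weight 0 marks an index outside the program; positivity at both ends of a conflict is what keeps
    minimising values bounded. *)
Definition weights W Y e :=
  [/\ forall i, 0 <= W i, forall j, 0 <= Y j &
      forall i j, e i j -> 0 < W i /\ 0 < Y j].

Definition optimal W Y e a d :=
  feasible e a d /\
  forall a' d', feasible e a' d' -> cost W Y a d <= cost W Y a' d'.

Lemma cost_ge0 W Y e a d : weights W Y e -> feasible e a d -> 0 <= cost W Y a d.
Proof.
move=> [W0 Y0 _] [a0 d0 _].
by rewrite addr_ge0// sumr_ge0// => i _; rewrite mulr_ge0.
Qed.

Lemma cost_gel W Y e a d i : weights W Y e -> feasible e a d ->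
  W i * a i <= cost W Y a d.
Proof.
move=> [W0 Y0 _] [a0 d0 _]; rewrite /cost (bigD1 i)//= -addrA lerDl.
by rewrite addr_ge0// sumr_ge0// => j _; rewrite mulr_ge0.
Qed.

Lemma cost_ger W Y e a d j : weights W Y e -> feasible e a d ->
  Y j * d j <= cost W Y a d.
Proof.
move=> [W0 Y0 _] [a0 d0 _]; rewrite /cost [X in _ <= _ + X](bigD1 j)//=.
rewrite addrCA lerDl.
by rewrite addr_ge0// sumr_ge0// => i _; rewrite mulr_ge0.
Qed.

(** The feasible set is unbounded, but the value 1 at all positive weights is feasible with cost
    [C]. A competitor of cost less than [C], once its values at zero weights are set to 0, lies in a
    compact box, and this change affects neither feasibility nor cost. *)
Lemma optimal_exists W Y e : weights W Y e -> exists a d, optimal W Y e a d.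
Proof.
move=> we; have [W0 Y0 eWY] := we.
pose C := \sum_i W i + \sum_j Y j.
pose one (V : 'I_n -> R) i : R := ((0 < V i)%R : bool)%:R.
have fe1 : feasible e (one W) (one Y).
  split=> [i|j|i j /eWY[Wi Yj]]; rewrite /one ?ler0n//.
  by rewrite Wi Yj mulr1.
have c1 : cost W Y (one W) (one Y) = C.
  congr (_ + _); apply: eq_bigr => i _; rewrite /one.
    by have := W0 i; rewrite le0r => /orP[/eqP->|->]; rewrite ?mul0r ?mulr1.
  by have := Y0 i; rewrite le0r => /orP[/eqP->|->]; rewrite ?mul0r ?mulr1.
have WC i : W i <= C.
  rewrite /C (bigD1 i)//= -addrA lerDl.
  by rewrite addr_ge0// sumr_ge0.
have YC i : Y i <= C.
  rewrite /C [X in _ + X](bigD1 i)//= addrCA lerDl.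
  by rewrite addr_ge0// sumr_ge0.
pose T := ('rV[R]_n * 'rV[R]_n)%type.
(* Where [V i = 0] the quotient [C / V i] is 0, so the box forces the value 0 there. *)
pose box (V : 'I_n -> R) := [set v : 'rV[R]_n | forall i, `[0, C / V i]%classic (v ord0 i)].
pose K : set T := box W `*` box Y.
pose B : set T := \bigcap_(ij in [set ij | e ij.1 ij.2])
   [set z : T | 1 <= z.1 0 ij.1 * z.2 0 ij.2].
have c1P i : continuous (fun z : T => z.1 0 i).
  move=> z; apply: (@continuous_comp _ _ _ fst (fun M : 'rV[R]_n => M 0 i)).
    exact: cvg_fst.
  exact: coord_continuous.
have c2P i : continuous (fun z : T => z.2 0 i).
  move=> z; apply: (@continuous_comp _ _ _ snd (fun M : 'rV[R]_n => M 0 i)).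
    exact: cvg_snd.
  exact: coord_continuous.
have cK : compact K.
  exact: (compact_setX (rV_compact (fun i => @segment_compact R 0 (C / W i)))
    (rV_compact (fun i => @segment_compact R 0 (C / Y i)))).
have cB : closed B.
  apply: closed_bigI => -[i j] _ /=.
  apply: (@preimage_closed _ _ (fun z : T => z.1 0 i * z.2 0 j) [set x : R | 1 <= x]).
    by move=> z _; apply: cvgM; [exact: c1P|exact: c2P].
  exact: closed_ge.
pose f (z : T) := cost W Y (fun i => z.1 0 i) (fun j => z.2 0 j).
have cf : continuous f.
  move=> z; apply: cvgD; apply: cvg_sumr => i _;
    apply: cvgM; try exact: cvg_cst; [exact: c1P|exact: c2P].
have KB a d : feasible e a d -> (forall i, a i <= C / W i) ->
    (forall j, d j <= C / Y j) -> (K `&` B) (\row_i a i, \row_j d j).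
  move=> [a0 d0 ad] aC dC; split.
    by split=> i /=; rewrite mxE in_itv/= ?a0 ?d0 ?aC ?dC.
  by move=> -[i j] /= eij; rewrite !mxE; exact: ad.
have C0 : 0 <= C by rewrite addr_ge0// sumr_ge0.
have oneC V i : 0 <= V i -> V i <= C -> one V i <= C / V i.
  rewrite /one le0r => /orP[/eqP->|V0 VC]; first by rewrite ltxx invr0 mulr0.
  by rewrite V0 ler_pdivlMr// mul1r.
have [|z /set_mem[[Kz1 Kz2] Bz] zmin] :=
    compact_EVT_min _ (compact_closedI cK cB) (continuous_subspaceT cf).
  exists (\row_i one W i, \row_j one Y j); apply: KB => // i; exact: oneC.
exists (fun i => z.1 0 i), (fun j => z.2 0 j); split.
  split=> [i|j|i j eij].
  - by have := Kz1 i; rewrite /= in_itv/= => /andP[].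
  - by have := Kz2 j; rewrite /= in_itv/= => /andP[].
  - exact: (Bz (i, j)).
move=> a d fe; have [a0 d0 ad] := fe.
have fE a' d' : f (\row_i a' i, \row_j d' j) = cost W Y a' d'.
  by congr (_ + _); apply: eq_bigr => i _; rewrite mxE.
have [Cc|Cc] := leP C (cost W Y a d).
  apply: le_trans Cc; rewrite -c1 -(fE (one W) (one Y)); apply/zmin/mem_set/KB => // i; exact: oneC.
have fe' : feasible e (fun i => one W i * a i) (fun j => one Y j * d j).
  split=> [i|j|i j eij]; rewrite /one ?mulr_ge0//.
  by have [-> ->] := eWY _ _ eij; rewrite !mul1r; exact: ad.
have c' : cost W Y (fun i => one W i * a i) (fun j => one Y j * d j) = cost W Y a d.
  congr (_ + _); apply: eq_bigr => i _; rewrite /one.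
    by have := W0 i; rewrite le0r => /orP[/eqP->|->]; rewrite ?mul0r ?mul1r.
  by have := Y0 i; rewrite le0r => /orP[/eqP->|->]; rewrite ?mul0r ?mul1r.
rewrite -c' -(fE (fun i => one W i * a i)); apply/zmin/mem_set/KB => // i; rewrite /one.
  have := W0 i; rewrite le0r => /orP[/eqP->|Wi]; first by rewrite ltxx invr0 mulr0 mul0r.
  rewrite Wi mul1r ler_pdivlMr// mulrC; apply: le_trans (ltW Cc).
  exact: cost_gel we fe.
have := Y0 i; rewrite le0r => /orP[/eqP->|Yi]; first by rewrite ltxx invr0 mulr0 mul0r.
rewrite Yi mul1r ler_pdivlMr// mulrC; apply: le_trans (ltW Cc).
exact: cost_ger we fe.
Qed.

(** Otherwise lowering the single value [a i] to [k] would stay feasible and save cost. With no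
    conflict at [i] the choice [k = 0] applies. *)
Lemma optimal_min_le W Y e a d i k : weights W Y e -> optimal W Y e a d ->
  0 < W i -> 0 <= k -> (forall j, e i j -> 1 <= k * d j) -> a i <= k.
Proof.
move=> we [[a0 d0 ad] mn] Wi k0 kd; have [//|ka] := leP (a i) k.
pose a' x := if x == i then k else a x.
have fe' : feasible e a' d.
  split=> [x|//|x j exj]; rewrite /a'; first by case: ifP.
  by case: eqP exj => [->/kd//|_]; exact: ad.
have := mn _ _ fe'; rewrite /cost lerD2r.
rewrite [\sum_x W x * a x](bigD1 i)//= [\sum_x W x * a' x](bigD1 i)//=.
rewrite {1}/a' eqxx [in X in _ <= X](eq_bigr (fun x => W x * a x)).
  by rewrite lerD2r ler_pM2l// => /(lt_le_trans ka); rewrite ltxx.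
by move=> x /negPf xi; rewrite /a' xi.
Qed.

Lemma optimal_sym W Y e a d :
  optimal W Y e a d -> optimal Y W (fun i j => e j i) d a.
Proof.
move=> [[a0 d0 ad] mn]; split=> [|a' d' [a'0 d'0 ad']].
  by split=> // i j /ad; rewrite mulrC.
rewrite /cost addrC [leRHS]addrC; apply: mn; split=> // i j eij.
by rewrite mulrC; exact: ad'.
Qed.

(** Multiply [a] by [q > 1] on [S] and divide [d] by [q] on [T]. Only the products with [j] in [T]
    and [i] outside [S] decrease, and these have slack. The cost changes by
    [(q - 1) / q * (q * A - D)], which would be negative for [q] close to 1 if [A < D]. *)
Lemma optimal_perturb W Y e a d (S T : {set 'I_n}) :
  weights W Y e -> optimal W Y e a d ->
  (forall i j, e i j -> j \in T -> i \notin S -> 1 < a i * d j) ->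
  \sum_(j in T) Y j * d j <= \sum_(i in S) W i * a i.
Proof.
move=> [W0 Y0 _] [[a0 d0 ad] mn] strict.
set D := \sum_(j in T) _; set A := \sum_(i in S) _.
have A0 : 0 <= A by apply: sumr_ge0 => i _; rewrite mulr_ge0.
have [//|AD] := leP D A.
have nstrict : \forall q \near (1 : R)^'+, forall ij : 'I_n * 'I_n,
    e ij.1 ij.2 -> ij.2 \in T -> ij.1 \notin S -> q <= a ij.1 * d ij.2.
  apply: filter_forall => -[i j] /=.
  have [/andP[eij /andP[jT iS]]|nij] := boolP [&& e i j, j \in T & i \notin S].
    by near=> q => _ _ _; near: q; apply: nbhs_right_le; exact: strict.
  by near=> q => eij jT iS; rewrite eij jT iS in nij.
have nA : \forall q \near (1 : R)^'+, q * A < D.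
  have [A1|A1] := eqVneq A 0.
    by near=> q; rewrite A1 mulr0 -A1.
  have Ap : 0 < A by rewrite lt0r A1.
  near=> q; rewrite -ltr_pdivlMr//; near: q; apply: nbhs_right_lt.
  by rewrite ltr_pdivlMr// mul1r.
near (1 : R)^'+ => q.
have q1 : 1 < q by near: q; exact: nbhs_right_gt.
have q0 : 0 < q by exact: lt_trans q1.
have sq : forall ij : 'I_n * 'I_n,
    e ij.1 ij.2 -> ij.2 \in T -> ij.1 \notin S -> q <= a ij.1 * d ij.2.
  by near: q.
have qA : q * A < D by near: q.
pose a' i := if i \in S then q * a i else a i.
pose d' j := if j \in T then q^-1 * d j else d j.
have fe' : feasible e a' d'.
  split=> [i|j|i j eij]; rewrite /a' /d'.
  - by case: ifP => // _; rewrite mulr_ge0// ltW.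
  - by case: ifP => // _; rewrite mulr_ge0// invr_ge0 ltW.
  - have := sq (i, j) eij; rewrite /=; have := ad _ _ eij.
    case: ifP => iS; case: ifP => jT //= h.
    + by rewrite mulrACA divff ?gt_eqF// mul1r.
    + by move=> _; rewrite -mulrA (le_trans h)// ler_peMl// ?(le_trans _ h)// ltW.
    + move=> /(_ isT isT) qad.
      by rewrite mulrCA mulrC ler_pdivlMr// mul1r.
have := mn _ _ fe'; rewrite /cost.
have -> : \sum_i W i * a' i = \sum_i W i * a i + (q - 1) * A.
  rewrite [A]big_mkcond/= mulr_sumr -big_split; apply: eq_bigr => i _ /=.
  by rewrite /a'; case: ifP => _; ring.
have -> : \sum_i Y i * d' i = \sum_i Y i * d i + (q^-1 - 1) * D.
  rewrite [D]big_mkcond/= mulr_sumr -big_split; apply: eq_bigr => i _ /=.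
  by rewrite /d'; case: ifP => _; ring.
rewrite addrACA lerDl.
have -> : (q - 1) * A + (q^-1 - 1) * D = (q - 1) * q^-1 * (q * A - D).
  by field; rewrite gt_eqF.
rewrite pmulr_rge0 ?subr_ge0 1?leNgt ?qA//.
by rewrite mulr_gt0// ?invr_gt0// subr_gt0.
Unshelve. all: by end_near. Qed.

(** Scaling all of [a] against all of [d] keeps every product, so the perturbation is allowed in
    both directions. *)
Lemma optimal_balance W Y e a d : weights W Y e -> optimal W Y e a d ->
  \sum_i W i * a i = \sum_j Y j * d j.
Proof.
move=> we op.
have sT (f : 'I_n -> R) : \sum_(i in finset.setTfor 'I_n) f i = \sum_i f i.
  by apply: eq_bigl => i; rewrite finset.in_setT.
apply/eqP; rewrite eq_le; apply/andP; split.
  have we' : weights Y W (fun i j => e j i).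
    by have [W0 Y0 eWY] := we; split=> // i j /eWY[].
  have := optimal_perturb (S := finset.setTfor 'I_n) (T := finset.setTfor 'I_n)
    we' (optimal_sym op).
  by rewrite !sT; apply => ? ? ? ?; rewrite finset.in_setT.
have := optimal_perturb (S := finset.setTfor 'I_n) (T := finset.setTfor 'I_n) we op.
by rewrite !sT; apply => ? ? ? ?; rewrite finset.in_setT.
Qed.

Definition upper_set e i (U : {set 'I_n} * {set 'I_n}) :=
  (i \in U.1) && [forall x, forall y, (x \in U.1) && e x y ==> (y \in U.2)].

Definition lower_set e i (L : {set 'I_n} * {set 'I_n}) :=
  (i \in L.1) && [forall x, forall y, (y \in L.2) && e x y ==> (x \in L.1)].

Definition set_ratio W Y (L U : {set 'I_n} * {set 'I_n}) :=
  (\sum_(j in L.2 :&: U.2) Y j) / (\sum_(i in L.1 :&: U.1) W i).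

(** Analogue of the max-min formula of isotonic regression, with ratios of two sums of weights in
    place of averages. The initial values are harmless: ratios of nonnegative weights are
    nonnegative, and the full pair is itself an upper set. *)
Definition maxmin W Y e i :=
  \big[Num.max/0]_(L | lower_set e i L)
    \big[Num.min/set_ratio W Y L (finset.setTfor 'I_n, finset.setTfor 'I_n)]_(U | upper_set e i U)
      set_ratio W Y L U.

(* The extremal L and U are the level sets of the optimum at the value a i:
   moving the part of it in their intersection does not lower the cost. *)
Lemma optimal_maxmin W Y e a d i : weights W Y e -> optimal W Y e a d ->
  0 < W i -> a i ^+ 2 = maxmin W Y e i.
Proof.
move=> we op Wi; have [[a0 d0 ad] mn] := op; have [W0 Y0 eWY] := we.
have we' : weights Y W (fun i j => e j i) by split=> // x y /eWY[].
have den (L U : {set 'I_n}) : i \in L -> i \in U -> 0 < \sum_(i in L :&: U) W i.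
  move=> iL iU; rewrite (bigD1 i) ?inE ?iL//= ltr_wpDr// sumr_ge0//.
have num (S : {set 'I_n}) : 0 <= \sum_(j in S) Y j by rewrite sumr_ge0.
apply/eqP; rewrite eq_le; apply/andP; split.
  pose L := ([set x | a i <= a x]%SET, [set y | a i * d y <= 1]%SET).
  have Li : lower_set e i L.
    rewrite /lower_set inE lexx/=; apply/forallP => x; apply/forallP => y.
    apply/implyP => /andP[]; rewrite !inE => ady exy.
    have dy : 0 < d y.
      by rewrite lt0r d0 andbT; apply: contraTneq (ad _ _ exy) => ->; rewrite mulr0 ler10.
    by rewrite -(ler_pM2r dy) (le_trans ady)// ad.
  have LU U : upper_set e i U -> a i ^+ 2 <= set_ratio W Y L U.
    move=> /andP[iU /forallP uU].
    have iL : i \in L.1 by rewrite inE.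
    rewrite /set_ratio ler_pdivlMr ?den//.
    have [->|ai0] := eqVneq (a i) 0; first by rewrite expr0n/= mul0r num.
    have ai : 0 < a i by rewrite lt0r ai0 a0.
    (* The slack for the transposed perturbation: a partner [y] of [x] lies in [U.2] by closure, so
       if it is outside the intersection then [1 < a i * d y <= a x * d y]. *)
    have h : \sum_(x in L.1 :&: U.1) W x * a x <= \sum_(y in L.2 :&: U.2) Y y * d y.
      apply: (optimal_perturb we' (optimal_sym op)) => y x exy.
      rewrite !inE => /andP[aix xU]; rewrite negb_and -ltNge.
      have -> : y \in U.2 by have /forallP/(_ y)/implyP := uU x; apply; rewrite xU.
      rewrite orbF => ady; rewrite mulrC (lt_le_trans ady)// ler_wpM2r//.
    rewrite expr2 -mulrA -ler_pdivlMl// !mulr_sumr.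
    apply: (@le_trans _ _ (\sum_(x in L.1 :&: U.1) W x * a x)).
      by apply: ler_sum => x; rewrite !inE => /andP[aix _]; rewrite mulrC ler_wpM2l.
    apply: (le_trans h); apply: ler_sum => y; rewrite !inE => /andP[ady _].
    by rewrite mulrC ler_wpM2r// -[_^-1]mulr1 ler_pdivlMl.
  apply: le_trans (le_bigmax_cond _ _ Li).
  by apply: le_bigmin => [|U /LU//]; apply: LU; rewrite /upper_set finset.in_setT/=;
     apply/forallP => x; apply/forallP => y; rewrite !finset.in_setT implybT.
apply: bigmax_le => [|L /andP[iL /forallP lL]]; first exact: sqr_ge0.
have iU : i \in [set x | a x <= a i]%SET by rewrite inE.
(* A zero value means that [i] is in no conflict, so [i] alone is an upper set and its ratio is
   0. *)
have [ai0|ai0] := eqVneq (a i) 0.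
  have noe j : ~~ e i j.
    by apply/negP => /ad; rewrite ai0 mul0r leNgt ltr01.
  pose U := ([set i]%SET, finset.set0 : {set 'I_n}).
  apply: le_trans (bigmin_le_cond _ (j := U) _ _) _.
    rewrite /upper_set !inE eqxx/=; apply/forallP => x; apply/forallP => y.
    by apply/implyP; rewrite !inE => /andP[/eqP->]; rewrite (negPf (noe y)).
  by rewrite /set_ratio finset.setI0 big_set0 mul0r sqr_ge0.
have ai : 0 < a i by rewrite lt0r ai0 a0.
pose U := ([set x | a x <= a i]%SET, [set y | 1 <= a i * d y]%SET).
apply: le_trans (bigmin_le_cond _ (j := U) _ _) _.
  rewrite /upper_set inE lexx/=; apply/forallP => x; apply/forallP => y.
  apply/implyP => /andP[]; rewrite !inE => axi exy.
  by rewrite (le_trans (ad _ _ exy))// ler_wpM2r.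
rewrite /set_ratio ler_pdivrMr ?den//.
have h : \sum_(y in L.2 :&: U.2) Y y * d y <= \sum_(x in L.1 :&: U.1) W x * a x.
  apply: (optimal_perturb we op) => x y exy.
  rewrite !inE => /andP[yL ady]; rewrite negb_and -ltNge.
  have -> : x \in L.1 by have /forallP/(_ y)/implyP := lL x; apply; rewrite yL.
  move=> /= axi; apply: (le_lt_trans ady); rewrite ltr_pM2r//.
  by rewrite lt0r d0 andbT; apply: contraTneq ady => ->; rewrite mulr0 ler10.
rewrite expr2 -mulrA -ler_pdivrMl//.
apply: (@le_trans _ _ (\sum_(y in L.2 :&: U.2) Y y * d y)).
  rewrite mulr_sumr; apply: ler_sum => y; rewrite !inE => /andP[_ ady].
  by rewrite mulrC ler_wpM2l// -[_^-1]mulr1 ler_pdivrMl.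
apply: (le_trans h); rewrite mulr_sumr; apply: ler_sum => x.
by rewrite !inE => /andP[_ axi]; rewrite mulrC ler_wpM2r.
Qed.

(** Both squares equal the same [maxmin], which is computed from the data of the program. *)
Lemma optimal_unique W Y e a d a' d' i : weights W Y e ->
  optimal W Y e a d -> optimal W Y e a' d' -> 0 < W i -> a i = a' i.
Proof.
move=> we op op' Wi; have [[a0 _ _] _] := op; have [[a'0 _ _] _] := op'.
apply/eqP; rewrite -(eqrXn2 (n := 2))//.
by rewrite (optimal_maxmin we op)// (optimal_maxmin we op').
Qed.

(** Dropping the constraints between [I] and the complement of [J] can only lower the minimum, and
    then the program splits into two. If the glued optima happen to satisfy the dropped constraints,
    they are optimal for the whole. *)
Lemma optimal_decouple W Y e (I J : {set 'I_n}) a1 d1 a2 d2 :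
  let restr (S : {set 'I_n}) (V : 'I_n -> R) i := if i \in S then V i else 0 in
  weights W Y e ->
  (forall i j, e i j -> j \in J -> i \in I) ->
  optimal (restr I W) (restr J Y) [rel i j | e i j && (j \in J)] a1 d1 ->
  optimal (restr (~: I) W) (restr (~: J) Y)
    [rel i j | [&& e i j, i \notin I & j \notin J]] a2 d2 ->
  (forall i j, e i j -> i \in I -> j \notin J -> 1 <= a1 i * d2 j) ->
  optimal W Y e (fun i => if i \in I then a1 i else a2 i)
    (fun j => if j \in J then d1 j else d2 j).
Proof.
move=> restr [W0 Y0 eWY] JI [[a10 d10 ad1] mn1] [[a20 d20 ad2] mn2] cross.
have costE a d : cost W Y a d = cost (restr I W) (restr J Y) a d +
    cost (restr (~: I) W) (restr (~: J) Y) a d.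
  rewrite /cost addrACA; congr (_ + _); rewrite -big_split; apply: eq_bigr => i _ /=;
    by rewrite /restr inE; case: ifP => _ /=; rewrite mul0r ?addr0 ?add0r.
split=> [|a d [a0 d0 ad]].
  split=> [i|j|i j eij]; [by case: ifP|by case: ifP|].
  case: ifPn => iI; case: ifPn => jJ.
  - by apply: ad1; rewrite /= eij.
  - exact: cross.
  - by rewrite (JI _ _ eij jJ) in iI.
  - by apply: ad2; rewrite /= eij iI.
have restrE (S : {set 'I_n}) V u v :
    \sum_i restr S V i * (if i \in S then u i else v i) = \sum_i restr S V i * u i.
  by apply: eq_bigr => i _; rewrite /restr; case: ifP; rewrite ?mul0r.
have restrC (S : {set 'I_n}) V u v :
    \sum_i restr (~: S) V i * (if i \in S then u i else v i) =
    \sum_i restr (~: S) V i * v i.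
  by apply: eq_bigr => i _; rewrite /restr inE; case: (i \in S); rewrite /= ?mul0r.
rewrite !costE /cost !restrE !restrC; apply: lerD.
  by apply: mn1; split=> // i j /andP[/ad].
by apply: mn2; split=> // i j /andP[/ad].
Qed.

End Program.
(** * Action of polygonal paths *)

Section EuclideanNorm.
Context {R : realType} {M : nat}.
Implicit Types u v : 'rV[R]_M.

Lemma enorm_ge0 u : 0 <= enorm u.
Proof. exact: sqrtr_ge0. Qed.

Lemma sqr_enorm u : enorm u ^+ 2 = \sum_i u 0 i ^+ 2.
Proof.
rewrite sqr_sqrtr; first by apply: eq_bigr => i _; rewrite expr2.
by apply: sumr_ge0 => i _; rewrite -expr2 sqr_ge0.
Qed.

Lemma coord_le_enorm u i : u 0 i ^+ 2 <= enorm u ^+ 2.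
Proof. by rewrite sqr_enorm (bigD1 i)//= lerDl sumr_ge0// => j _; rewrite sqr_ge0. Qed.

Lemma enorm0 : enorm (0 : 'rV[R]_M) = 0.
Proof. by apply/eqP; rewrite -sqrf_eq0 sqr_enorm big1// => i _; rewrite mxE expr0n. Qed.

Lemma enorm_sym u v : enorm (u - v) = enorm (v - u).
Proof.
apply/eqP; rewrite -(eqrXn2 (n := 2)) ?enorm_ge0// !sqr_enorm; apply/eqP.
by apply: eq_bigr => i _; rewrite !mxE -sqrrN opprB.
Qed.

End EuclideanNorm.

(** Cauchy-Schwarz for two terms, in a form free of square roots: bounds of squared displacement by
    time times action add up along consecutive pieces. *)
Lemma cauchy_add {R : realType} (x y a b e f : R) :
  0 <= a -> 0 <= b -> 0 <= e -> 0 <= f ->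
  x ^+ 2 <= a * e -> y ^+ 2 <= b * f -> (x + y) ^+ 2 <= (a + b) * (e + f).
Proof.
move=> a0 b0 e0 f0 xae ybf.
suff : 2 * x * y <= a * f + b * e by nra.
rewrite leNgt; apply/negP => h.
have s0 : 0 <= a * f + b * e by rewrite addr_ge0// mulr_ge0.
have h2 : (a * f + b * e) ^+ 2 < (2 * x * y) ^+ 2.
  by rewrite ltrXn2r// ?(le_trans s0 (ltW h)).
have h3 : x ^+ 2 * y ^+ 2 <= (a * e) * (b * f) by rewrite ler_pM// sqr_ge0.
have := sqr_ge0 (a * f - b * e); nra.
Qed.

(* The action of a path through y at time r exceeds that of the straight path
   by the square of the deviation of y from the latter. *)
Lemma action_deviation {R : realType} (p y z r tau e f : R) :
  0 <= r -> r < tau -> 0 <= e -> 0 <= f ->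
  (y - p) ^+ 2 <= r * e -> (z - y) ^+ 2 <= (tau - r) * f ->
  (z - p) ^+ 2 / tau + (y - (p + r / tau * (z - p))) ^+ 2 / r <= e + f.
Proof.
move=> r0 rt e0 f0 ype zyf.
have t0 : 0 < tau by exact: le_lt_trans rt.
have tr0 : 0 < tau - r by rewrite subr_gt0.
(* At [r = 0] the deviation term is 0 because the inverse of 0 is 0, and [y = p]. *)
move: r0; rewrite le_eqVlt => /predU1P[r0|r0].
  rewrite -r0 invr0 mulr0 addr0 ler_pdivrMr//.
  have yp : y = p.
    apply/eqP; rewrite -subr_eq0 -sqrf_eq0 eq_le sqr_ge0 andbT.
    by rewrite (le_trans ype)// -r0 mul0r.
  move: zyf; rewrite yp -r0 subr0 => /le_trans; apply.
  by rewrite mulrC ler_wpM2r ?(ltW t0)// lerDr.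
have e1 : (y - p) ^+ 2 / r <= e by rewrite ler_pdivrMr// mulrC.
have f1 : (z - y) ^+ 2 / (tau - r) <= f by rewrite ler_pdivrMr// mulrC.
apply: le_trans (lerD e1 f1).
have -> : (y - p) ^+ 2 / r + (z - y) ^+ 2 / (tau - r) =
   (z - p) ^+ 2 / tau + (y - (p + r / tau * (z - p))) ^+ 2 / r +
   (y - (p + r / tau * (z - p))) ^+ 2 / (tau - r).
  by field; rewrite !gt_eqF.
by rewrite lerDl mulr_ge0 ?sqr_ge0// invr_ge0 ltW.
Qed.

Section Polygons.
Context {R : realType} {M : nat} (cmp : rel 'I_M).
Implicit Types (p x y u v : 'rV[R]_M) (c T : R).

(* u and v lie in a common closed orthant of the space. *)
Definition adj u v := forall i j, u 0 i != 0 -> v 0 j != 0 -> cmp i j.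

(** Time is only an upper allowance for each step, so the total length is at most [c * T]. With
    [c = 1] time stands for length; with [c] the length of a geodesic it is the parameter on
    [0, 1]. *)
Inductive polygon c : 'rV[R]_M -> 'rV[R]_M -> R -> Prop :=
| polygon_nil p : polygon c p p 0
| polygon_rcons p q y T r : polygon c p q T -> adj q y -> 0 <= r ->
    enorm (y - q) <= c * r -> polygon c p y (T + r).

Lemma polygon_time_ge0 c p x T : polygon c p x T -> 0 <= T.
Proof. by elim=> [//|{p x T} p q y T r _ T0 _ r0 _]; rewrite addr_ge0. Qed.

Lemma polygon_trans c p q x T T' :
  polygon c p q T -> polygon c q x T' -> polygon c p x (T + T').
Proof.
move=> pq qx; elim: qx pq => [y|{x T'} u v y T' r _ IH vy r0 lv] pq.
  by rewrite addr0.
by rewrite addrA; apply: polygon_rcons (IH pq) vy r0 lv.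
Qed.

Lemma polygon1 c p x T : adj p x -> 0 <= T -> enorm (x - p) <= c * T ->
  polygon c p x T.
Proof.
by move=> px T0 lpx; rewrite -[T]add0r; apply: polygon_rcons px T0 lpx; exact: polygon_nil.
Qed.

Lemma polygon_sym c p x T : symmetric cmp -> polygon c p x T -> polygon c x p T.
Proof.
move=> sc; elim=> [y|{p x T} u v y T r _ IH vy r0 lv]; first exact: polygon_nil.
rewrite addrC; apply: polygon_trans IH; apply: polygon1 => //.
  by move=> i j yi vj; rewrite sc; exact: vy.
by rewrite enorm_sym.
Qed.

Definition vanishing p x i := (p 0 i != 0) && (x 0 i == 0).

Definition vweight p x i := if vanishing p x i then p 0 i ^+ 2 else 0.

Definition conflict p x : rel 'I_M :=
  fun i j => [&& vanishing p x i, vanishing x p j & ~~ cmp i j].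

Lemma vweight_ge0 p x i : 0 <= vweight p x i.
Proof. by rewrite /vweight; case: ifP => // _; exact: sqr_ge0. Qed.

Lemma vweight_gt0 p x i : vanishing p x i -> 0 < vweight p x i.
Proof. by move=> v; rewrite /vweight v lt0r sqr_ge0 sqrf_eq0 andbT; case/andP: v. Qed.

Lemma conflict_weights p x : weights (vweight p x) (vweight x p) (conflict p x).
Proof.
split; try by move=> ?; exact: vweight_ge0.
by move=> i j /and3P[vi vj _]; rewrite !vweight_gt0.
Qed.

(* Coordinate i decreases linearly from p_i to 0 at time 1 / (1 + a_i), and
   coordinate j increases linearly to x_j from time d_j / (1 + d_j) on; then
   a_i * d_j >= 1 says that i has vanished when j appears. *)
Definition schedule p x (a d : 'I_M -> R) (t : R) : 'rV[R]_M :=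
  \row_i if vanishing p x i then p 0 i * Num.max 0 (1 - (1 + a i) * t)
         else if vanishing x p i then x 0 i * Num.max 0 (1 - (1 + d i) * (1 - t))
         else p 0 i + t * (x 0 i - p 0 i).

(** The time integral over [0, 1] of the squared speed of [schedule]: a vanishing coordinate moves
    at speed [(1 + a i) * p i] during time [1 / (1 + a i)], which costs [p i ^+ 2 * (1 + a i)]. *)
Definition action p x a d :=
  enorm (x - p) ^+ 2 + cost (vweight p x) (vweight x p) a d.

(** Array form of a polygon with its clock, so that the first or last vertex at which a coordinate
    is 0 can be named. *)
Record indexed c n (q : nat -> 'rV[R]_M) (t : nat -> R) : Prop := Indexed {
  indexed0 : t 0%N = 0;
  indexed_adj : forall k, (k < n)%N -> adj (q k) (q k.+1);
  indexed_time : forall k, (k < n)%N -> t k <= t k.+1;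
  indexed_speed : forall k, (k < n)%N ->
    enorm (q k.+1 - q k) <= c * (t k.+1 - t k) }.

(** Keeping the old entries leaves the junction of two polygons at a known index, which
    [polygon_action] uses for its intermediate point. *)
Lemma indexed_extend c y x T : polygon c y x T ->
  forall n (q : nat -> 'rV[R]_M) t, indexed c n q t -> q n = y ->
  exists n' q' t', [/\ (n <= n')%N, indexed c n' q' t', q' n' = x,
    t' n' = t n + T & forall k, (k <= n)%N -> q' k = q k /\ t' k = t k].
Proof.
elim=> [z|{y x T} p u v T r _ IH uv r0 luv] n q t iq qn.
  by exists n, q, t; rewrite addr0; split.
have [n' [q' [t' [nn' iq' q'u t'n agr]]]] := IH _ _ _ iq qn.
exists n'.+1, (fun k => if (k <= n')%N then q' k else v),
  (fun k => if (k <= n')%N then t' k else t' n' + r).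
split; rewrite ?ltnn ?t'n ?addrA//; first exact: leqW.
- split=> [|k|k|k]; rewrite ?(indexed0 iq')//= ltnS => kn'; rewrite kn';
    move: kn'; rewrite leq_eqVlt => /predU1P[->|kn'].
  + by rewrite ltnn q'u.
  + by rewrite kn'; exact: indexed_adj iq' _ kn'.
  + by rewrite ltnn t'n lerDl.
  + by rewrite kn'; exact: indexed_time iq' _ kn'.
  + by rewrite ltnn q'u t'n addrAC subrr add0r.
  + by rewrite kn'; exact: indexed_speed iq' _ kn'.
- by move=> k kn; rewrite (leq_trans kn nn'); exact: agr.
Qed.

Lemma indexed_nil c p : indexed c 0 (fun=> p) (fun=> 0).
Proof. by []. Qed.

(** A step of duration 0 contributes 0, in agreement with the speed bound, which forces it to be
    trivial. *)
Definition step_action (q : nat -> 'rV[R]_M) (t : nat -> R) l i :=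
  (q l.+1 0 i - q l 0 i) ^+ 2 / (t l.+1 - t l).

Definition segment_action q t k l i := \sum_(k <= h < l) step_action q t h i.

Section Indexed.
Variables (c : R) (n : nat) (q : nat -> 'rV[R]_M) (t : nat -> R).
Hypothesis iq : indexed c n q t.

Lemma indexed_mono k l : (k <= l <= n)%N -> t k <= t l.
Proof.
move=> /andP[/subnKC <-]; elim: (l - k)%N => [|h IH]; first by rewrite addn0.
by rewrite addnS => kn; apply: le_trans (IH (ltnW kn)) _; exact: indexed_time iq _ kn.
Qed.

Lemma step_action_ge0 k i : (k < n)%N -> 0 <= step_action q t k i.
Proof. by move=> kn; rewrite mulr_ge0 ?sqr_ge0// invr_ge0 subr_ge0 (indexed_time iq). Qed.

Lemma segment_action_ge0 k l i : (l <= n)%N -> 0 <= segment_action q t k l i.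
Proof.
move=> ln; rewrite /segment_action big_nat_cond sumr_ge0// => h.
by rewrite andbT => /andP[_ hl]; rewrite step_action_ge0// (leq_trans hl).
Qed.

Lemma segment_action_cat k h l i : (k <= h)%N -> (h <= l)%N ->
  segment_action q t k l i = segment_action q t k h i + segment_action q t h l i.
Proof. by move=> kh hl; rewrite /segment_action (big_cat_nat kh hl). Qed.

Lemma segment_action_le k l i : (k <= l <= n)%N ->
  (q l 0 i - q k 0 i) ^+ 2 <= (t l - t k) * segment_action q t k l i.
Proof.
move=> /andP[/subnKC <-]; elim: (l - k)%N => [|h IH].
  by rewrite addn0 !subrr expr0n mul0r.
rewrite addnS => kn; have kh : (k <= k + h)%N := leq_addr _ _.
rewrite (segment_action_cat _ kh (leqnSn _)).
have -> : q (k + h).+1 0 i - q k 0 i =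
  (q (k + h)%N 0 i - q k 0 i) + (q (k + h).+1 0 i - q (k + h)%N 0 i) by ring.
have -> : t (k + h).+1 - t k = (t (k + h)%N - t k) + (t (k + h).+1 - t (k + h)%N) by ring.
have t1 := indexed_time iq kn.
apply: cauchy_add; rewrite ?subr_ge0 ?segment_action_ge0 ?IH ?(ltnW kn)//.
  by apply: indexed_mono; rewrite kh ltnW.
rewrite /segment_action big_nat1 /step_action.
have [t0|t0] := eqVneq (t (k + h).+1 - t (k + h)%N) 0; last by rewrite mulrCA divff// mulr1.
have e0 : enorm (q (k + h).+1 - q (k + h)%N) = 0.
  by apply/eqP; rewrite eq_le enorm_ge0 (le_trans (indexed_speed iq kn))// t0 mulr0.
by have := coord_le_enorm (q (k + h).+1 - q (k + h)%N) i; rewrite e0 expr0n/= !mxE t0 mul0r.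
Qed.

Lemma total_action_le : \sum_i segment_action q t 0 n i <= c ^+ 2 * t n.
Proof.
have -> : t n = \sum_(0 <= k < n) (t k.+1 - t k).
  by rewrite telescope_sumr// (indexed0 iq) subr0.
rewrite /segment_action exchange_big/= mulr_sumr.
apply: ler_sum_nat => k /andP[_ kn].
rewrite /step_action -mulr_suml.
have tk : 0 <= t k.+1 - t k by rewrite subr_ge0 (indexed_time iq).
have [->|tk0] := eqVneq (t k.+1 - t k) 0; first by rewrite invr0 !mulr0.
have t0 : 0 < t k.+1 - t k by rewrite lt0r tk0.
rewrite ler_pdivrMr// -mulrA -expr2 -exprMn.
have -> : \sum_i (q k.+1 0 i - q k 0 i) ^+ 2 = enorm (q k.+1 - q k) ^+ 2.
  by rewrite sqr_enorm; apply: eq_bigr => i _; rewrite !mxE.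
by rewrite lerXn2r ?nnegrE ?enorm_ge0 ?(le_trans (enorm_ge0 _) (indexed_speed iq kn))//
  (indexed_speed iq).
Qed.

Lemma coord_action_le i : segment_action q t 0 n i <= c ^+ 2 * t n.
Proof.
apply: le_trans total_action_le; rewrite (bigD1 i)//= lerDl.
by rewrite sumr_ge0// => j _; exact: segment_action_ge0.
Qed.

End Indexed.

Lemma polygon_dist_le c p x T : 0 <= c -> polygon c p x T -> enorm (x - p) <= c * T.
Proof.
move=> c0 px; have [n [q [t [_ iq qn tn agr]]]] := indexed_extend px (indexed_nil c p) erefl.
have [q0 t0] := agr 0%N isT; rewrite add0r in tn.
have T0 := polygon_time_ge0 px.
rewrite -(@ler_pXn2r _ 2) ?nnegrE ?enorm_ge0 ?mulr_ge0// sqr_enorm.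
apply: (@le_trans _ _ (\sum_i T * segment_action q t 0 n i)).
  apply: ler_sum => i _; have := segment_action_le iq i (k := 0%N) (l := n).
  by rewrite leqnn qn tn q0 t0 subr0 !mxE => /(_ isT).
have -> : (c * T) ^+ 2 = T * (c ^+ 2 * t n) by rewrite tn; ring.
by rewrite -mulr_sumr ler_wpM2l//; exact: total_action_le iq.
Qed.

(** Each lost coordinate has a first zero and each gained one a last zero; taken as vanishing and
    appearance times they define [a] and [d]. Cauchy-Schwarz on the pieces of each coordinate bounds
    its share of the action, and [action_deviation] adds the penalty for [y]. The smallness of [r]
    ensures that no lost coordinate reaches 0 by time [r]. For [r = 0] the penalty is absent. *)
Lemma polygon_action c p y x r r' : 0 <= c -> 0 < r' ->
  polygon c p y r -> polygon c y x r' -> let T := r + r' in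
  (forall i, vanishing p x i -> r * (c ^+ 2 * T) < p 0 i ^+ 2) ->
  exists a d, feasible (conflict p x) a d /\
    action p x a d +
      T / r * \sum_i (y 0 i - schedule p x a d (r / T) 0 i) ^+ 2 <= c ^+ 2 * T ^+ 2.
Proof.
move=> c0 r'0 py yx T rsmall.
have [m [q1 [t1 [_ iq1 q1m t1m agr1]]]] := indexed_extend py (indexed_nil c p) erefl.
have [n [q [t [mn iq qn tn agr]]]] := indexed_extend yx iq1 q1m.
have {agr1} [q10 t10] := agr1 0%N isT.
have [q0 t0] := agr 0%N isT; have {agr} [qm tm] := agr m (leqnn m).
rewrite q10 in q0; rewrite t10 in t0; rewrite q1m in qm; rewrite t1m add0r in tm.
rewrite t1m add0r -/T in tn.
have r0 : 0 <= r := polygon_time_ge0 py.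
have T0 : 0 < T by rewrite ltr_wpDl.
have rT : r < T by rewrite ltrDl.
pose S := segment_action q t.
have S0 k l i : (l <= n)%N -> 0 <= S k l i.
  by move=> ln; rewrite /S; exact: (segment_action_ge0 iq _ _ ln).
have Sle k l i : (k <= l <= n)%N -> (q l 0 i - q k 0 i) ^+ 2 <= (t l - t k) * S k l i.
  by move=> kln; exact: (segment_action_le iq).
have tmono k l : (k <= l <= n)%N -> t k <= t l.
  by move=> kln; exact: (indexed_mono iq).
have ST i : S 0%N n i <= c ^+ 2 * T by rewrite -tn; exact: coord_action_le iq _.
(* k1 i is the first zero of coordinate i, and k2 j the last zero of coordinate
   j, except that k2 j = 0 if j is in no conflict: j may then appear at once. *)
have ex1 i : exists k, (k == n) || (q k 0 i == 0) by exists n; rewrite eqxx.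
pose k1 i := ex_minn (ex1 i).
have k1n i : (k1 i <= n)%N by rewrite /k1; case: ex_minnP => k _; apply; rewrite eqxx.
have k1z i : x 0 i = 0 -> q (k1 i) 0 i = 0.
  by rewrite /k1; case: ex_minnP => k /orP[/eqP->|/eqP//] _ x0; rewrite qn.
have k1min k i : (k < k1 i)%N -> q k 0 i != 0.
  rewrite /k1; case: ex_minnP => l _ lmin kl; apply/eqP => qk.
  by have := lmin k; rewrite qk eqxx orbT leqNgt kl => /(_ isT).
pose z2 j k := (k <= n)%N && ((k == 0%N) || (q k 0 j == 0)).
have ex2 j : exists k, z2 j k by exists 0%N; rewrite /z2 eqxx.
have bd2 j k : z2 j k -> (k <= n)%N by case/andP.
pose k2 j := if [exists i, conflict p x i j] then ex_maxn (ex2 j) (bd2 j) else 0%N.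
have k2n j : (k2 j <= n)%N by rewrite /k2; case: ifP => // _; case: ex_maxnP => k /andP[].
have k2z j : p 0 j = 0 -> q (k2 j) 0 j = 0.
  rewrite /k2 => pj; case: ifP => _; last by rewrite q0.
  by case: ex_maxnP => k /andP[_ /orP[/eqP->|/eqP//]] _; rewrite q0.
have k1k2 i j : conflict p x i j -> (k1 i <= k2 j)%N.
  move=> cij; have -> : k2 j = ex_maxn (ex2 j) (bd2 j).
    by rewrite /k2 ifT//; apply/existsP; exists i.
  case: ex_maxnP => k _; apply; rewrite /z2 k1n/=.
  have [//|] := eqVneq (k1 i) 0%N; rewrite -lt0n => k1p; rewrite /=.
  (* Coordinate [i] is nonzero at the vertex before [k1 i]; a nonzero coordinate [j] at [k1 i] would
     make [i] and [j] compatible by adjacency. Hence [k1 i] is among the zeros of [j]. *)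
  have /and3P[_ _ ncij] := cij.
  have [//|qj] := eqVneq (q (k1 i) 0 j) 0.
  have k1E := prednK k1p; case/negP: ncij.
  apply: (indexed_adj iq (k := (k1 i).-1)); rewrite ?k1E//.
  by apply: k1min; rewrite k1E.
pose tau i := t (k1 i); pose sigma j := t (k2 j).
(* Solved from [tau i = T / (1 + a i)] and [sigma j = T * d j / (1 + d j)]. *)
pose a i := (T - tau i) / tau i; pose d j := sigma j / (T - sigma j).
have tauT i : tau i <= T by rewrite -tn tmono// k1n leqnn.
have sigmaT j : sigma j <= T by rewrite -tn tmono// k2n leqnn.
have tau0 i : 0 <= tau i by rewrite -t0 tmono// k1n.
have sigma0 j : 0 <= sigma j by rewrite -t0 tmono// k2n.
(* Reaching 0 from [p 0 i] by time [tau i] requires [p 0 i ^+ 2 <= tau i * (c ^+ 2 * T)]. *)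
have rtau i : vanishing p x i -> r < tau i.
  move=> vi; have := rsmall i vi; case/andP: (vi) => pi /eqP xi.
  have := Sle 0%N (k1 i) i; rewrite k1n k1z// q0 t0 subr0 sub0r sqrrN => /(_ isT) h1 h2.
  have h3 : S 0%N (k1 i) i <= c ^+ 2 * T.
    by apply: le_trans (ST i); rewrite /S (segment_action_cat _ _ _ (leq0n _) (k1n i)) lerDl S0.
  have h4 : p 0 i ^+ 2 <= tau i * (c ^+ 2 * T).
    by apply: (le_trans h1); apply: ler_wpM2l h3; exact: tau0.
  have h5 := lt_le_trans h2 h4.
  by rewrite ltNge; apply/negP => tr; move: h5; rewrite ltNge ler_wpM2r// mulr_ge0 ?sqr_ge0 ?ltW.
have sigmaltT j : vanishing x p j -> sigma j < T.
  case/andP => xj /eqP pj; rewrite lt_neqAle sigmaT andbT; apply/eqP => sT.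
  have := Sle (k2 j) n j; rewrite k2n leqnn k2z// qn tn -/(sigma j) sT subrr mul0r subr0.
  by move=> /(_ isT); rewrite leNgt lt0r sqr_ge0 sqrf_eq0 xj.
have tausigma i j : conflict p x i j -> tau i <= sigma j.
  by move=> /k1k2 k12; apply: tmono; rewrite k12 k2n.
exists a, d; split.
  split=> [i|j|i j cij]; try by rewrite divr_ge0// subr_ge0.
  have /and3P[vi vj _] := cij; have ti := rtau i vi; have sj := sigmaltT j vj.
  have t0i : 0 < tau i by exact: le_lt_trans ti.
  have Ts : 0 < T - sigma j by rewrite subr_gt0.
  have -> : a i * d j = ((T - tau i) * sigma j) / (tau i * (T - sigma j)).
    by rewrite /a /d; field; rewrite !gt_eqF.
  rewrite ler_pdivlMr ?mulr_gt0// mul1r; have := tausigma i j cij; nra.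
have Sn k l i : (k <= l)%N -> (l <= n)%N -> S 0%N k i + S k l i <= S 0%N n i.
  move=> kl ln; rewrite /S -(segment_action_cat _ _ _ (leq0n _) kl).
  by rewrite [leRHS](segment_action_cat _ _ _ (leq0n _) ln) lerDl S0.
suff coord i : (x 0 i - p 0 i) ^+ 2 + vweight p x i * a i + vweight x p i * d i +
    T / r * (y 0 i - schedule p x a d (r / T) 0 i) ^+ 2 <= T * S 0%N n i.
  have -> : c ^+ 2 * T ^+ 2 = T * (c ^+ 2 * t n) by rewrite tn; ring.
  apply: (@le_trans _ _ (\sum_i T * S 0%N n i)); last first.
    by rewrite -mulr_sumr ler_wpM2l ?(ltW T0)//; exact: total_action_le iq.
  rewrite /action sqr_enorm /cost mulr_sumr addrA -!big_split/=.
  by apply: ler_sum => i _; apply: le_trans (coord i); rewrite !mxE.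
have rT1 : r / T < 1 by rewrite ltr_pdivrMr// mul1r.
have S0m := Sle 0%N m i; rewrite mn qm q0 tm t0 subr0 in S0m; have {}S0m := S0m isT.
have mk1 j : vanishing p x j -> (m <= k1 j)%N.
  move=> /rtau; rewrite leqNgt => h; apply/negP => k1m.
  by move: h; rewrite /tau -tm ltNge tmono// (ltnW k1m) mn.
have Tn0 : T != 0 by rewrite gt_eqF.
rewrite mxE /vweight; have [vi|nvi] := boolP (vanishing p x i).
  have /andP[pi /eqP xi] := vi; have ti := rtau i vi.
  have t0i : 0 < tau i by exact: le_lt_trans ti.
  have -> : vanishing x p i = false by rewrite /vanishing xi eqxx.
  have a1 : 1 + a i = T / tau i by rewrite /a; field; rewrite gt_eqF.
  have -> : (1 + a i) * (r / T) = r / tau i by rewrite a1; field; rewrite Tn0 gt_eqF.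
  have rt1 : 0 <= 1 - r / tau i by rewrite subr_ge0 ler_pdivrMr// mul1r ltW.
  rewrite (max_idPr rt1) mul0r addr0 xi.
  have mk := mk1 i vi; have := Sle m (k1 i) i; rewrite mk k1n k1z// qm tm => /(_ isT) Smk.
  have dev := action_deviation r0 ti (S0 _ _ _ mn) (S0 _ _ _ (k1n i)) S0m Smk.
  have := le_trans dev (Sn _ _ i mk (k1n i)); rewrite -(ler_pM2l T0).
  apply: le_trans; rewrite le_eqVlt; apply/orP; left; apply/eqP.
  have -> : p 0 i * (1 - r / tau i) = p 0 i + r / tau i * (0 - p 0 i) by ring.
  (* The inverse of [r] is generalised because [r] may be 0 and [field] would ask for [r != 0]. *)
  by move: (r^-1) => ri; rewrite /a; field; rewrite gt_eqF.
rewrite mul0r addr0; have [vj|nvj] := boolP (vanishing x p i); last first.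
  rewrite mul0r addr0.
  have := Sle m n i; rewrite mn leqnn qn qm tn tm => /(_ isT) Smn.
  have dev := action_deviation r0 rT (S0 _ _ _ mn) (S0 _ _ _ (leqnn n)) S0m Smn.
  have := le_trans dev (Sn _ _ i mn (leqnn n)); rewrite -(ler_pM2l T0).
  apply: le_trans; rewrite le_eqVlt; apply/orP; left; apply/eqP.
  by move: (r^-1) => ri; field.
have /andP[xi /eqP pi] := vj; rewrite pi subr0.
have sT := sigmaltT i vj; have Ts : 0 < T - sigma i by rewrite subr_gt0.
have d1 : 1 + d i = T / (T - sigma i) by rewrite /d; field; rewrite gt_eqF.
have [cj|ncj] := boolP [exists j, conflict p x j i].
  (* Coordinate [i] has to wait for [j] to vanish, hence beyond time [r]. The schedule is still 0
     there, so [y 0 i] itself is the deviation, paid for by the action before [k2 i]. *)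
  have /existsP[j cji] := cj; have /and3P[vj' _ _] := cji.
  have rs : r <= sigma i := le_trans (ltW (rtau j vj')) (tausigma j i cji).
  have mk2 : (m <= k2 i)%N := leq_trans (mk1 j vj') (k1k2 j i cji).
  have -> : 1 - (1 + d i) * (1 - r / T) = (r - sigma i) / (T - sigma i).
    by rewrite d1; field; rewrite Tn0 gt_eqF.
  rewrite (max_idPl _); last by rewrite mulr_le0_ge0 ?subr_le0// invr_ge0 ltW.
  rewrite mulr0 subr0.
  have y2 : T / r * y 0 i ^+ 2 <= T * S 0%N m i.
    have [->|rn0] := eqVneq r 0; first by rewrite invr0 mulr0 mul0r mulr_ge0 ?(ltW T0)// S0.
    rewrite -mulrA ler_wpM2l ?(ltW T0)// mulrC ler_pdivrMr ?lt0r ?rn0// mulrC.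
    by move: S0m; rewrite pi subr0.
  have := Sle (k2 i) n i; rewrite k2n leqnn qn k2z// subr0 tn => /(_ isT) S2.
  have x2 : x 0 i ^+ 2 / (T - sigma i) <= S (k2 i) n i by rewrite ler_pdivrMr// mulrC.
  have -> : x 0 i ^+ 2 + x 0 i ^+ 2 * d i = T * (x 0 i ^+ 2 / (T - sigma i)).
    by rewrite /d; field; rewrite gt_eqF.
  apply: (@le_trans _ _ (T * S (k2 i) n i + T * S 0%N m i)).
    by apply: lerD y2; apply: ler_wpM2l x2; exact: ltW.
  rewrite -mulrDr ler_wpM2l ?(ltW T0)// addrC; apply: le_trans (Sn _ _ i (k2n i) (leqnn n)).
  by rewrite lerD2r /S (segment_action_cat _ _ _ (leq0n _) mk2) lerDl S0.
have s0 : sigma i = 0 by rewrite /sigma /k2 (negPf ncj) t0.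
have di : d i = 0 by rewrite /d s0 mul0r.
have -> : 1 - (1 + d i) * (1 - r / T) = r / T by rewrite di; ring.
rewrite (max_idPr _) ?divr_ge0 ?(ltW T0)// di mulr0 addr0.
have := Sle m n i; rewrite mn leqnn qn qm tn tm => /(_ isT) Smn.
have dev := action_deviation r0 rT (S0 _ _ _ mn) (S0 _ _ _ (leqnn n)) S0m Smn.
have := le_trans dev (Sn _ _ i mn (leqnn n)); rewrite -(ler_pM2l T0).
apply: le_trans; rewrite le_eqVlt; apply/orP; left; apply/eqP.
rewrite pi subr0 add0r [x 0 i * _]mulrC.
by move: (r^-1) => ri; field.
Qed.

End Polygons.

(** * Coordinatewise limits, chaining along an interval, lengths of inscribed polygons *)

Lemma cvg_row {R : realType} {M : nat} {T : Type} (F : set_system T) {FF : Filter F}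
    (f : T -> 'rV[R]_M) (l : 'rV[R]_M) :
  (forall i, f x 0 i @[x --> F] --> l 0 i) -> f x @[x --> F] --> l.
Proof.
move=> fl A [P Pn PA]; apply: (@filterS _ F _ _ _ (fun x h => PA (f x) h)).
have h : \forall x \near F, forall i, P ord0 i (f x 0 i).
  by apply: filter_forall => i; exact: fl i _ (Pn ord0 i).
by apply: filterS h => x hx i j; rewrite ord1.
Qed.

Lemma cvg_coord {R : realType} {M : nat} {T : Type} (F : set_system T) {FF : Filter F}
    (f : T -> 'rV[R]_M) (l : 'rV[R]_M) i :
  f x @[x --> F] --> l -> f x 0 i @[x --> F] --> l 0 i.
Proof.
move=> fl; exact: (cvg_comp f (fun v : 'rV[R]_M => v 0 i) fl (@coord_continuous R 1 M 0 i l)).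
Qed.

Lemma cvg_maxr {R : realType} {T : Type} (F : set_system T) {FF : Filter F}
    (f g : T -> R) (a b : R) : f x @[x --> F] --> a -> g x @[x --> F] --> b ->
  Num.max (f x) (g x) @[x --> F] --> Num.max a b.
Proof.
move=> fa gb; rewrite maxr_absE; under eq_fun do rewrite maxr_absE.
apply: cvgM; last exact: cvg_cst.
by apply: cvgD; [exact: cvgD|apply: cvg_norm; exact: cvgB].
Qed.

Lemma cvg_minr {R : realType} {T : Type} (F : set_system T) {FF : Filter F}
    (f g : T -> R) (a b : R) : f x @[x --> F] --> a -> g x @[x --> F] --> b ->
  Num.min (f x) (g x) @[x --> F] --> Num.min a b.
Proof.
move=> fa gb; rewrite minr_absE; under eq_fun do rewrite minr_absE.
apply: cvgM; last exact: cvg_cst.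
by apply: cvgB; [exact: cvgD|apply: cvg_norm; exact: cvgB].
Qed.

(** Real induction: the supremum of the points reachable from [a] is reachable, and a supremum below
    [b] could be passed. It replaces a compactness argument when local adjacency is turned into
    finitely many steps. *)
Lemma segment_chain {R : realType} (P : R -> R -> Prop) (a b : R) :
  a <= b -> (forall t, a <= t <= b -> P t t) ->
  (forall s t u, a <= s -> s <= t -> t <= u -> u <= b -> P s t -> P t u -> P s u) ->
  (forall t, a <= t <= b -> \forall s \near t,
     (a <= s <= t -> P s t) /\ (t <= s <= b -> P t s)) ->
  P a b.
Proof.
move=> ab Pxx Ptr Ploc.
pose S := [set t | a <= t <= b /\ P a t].
have aS : S a by split; [rewrite lexx ab|apply: Pxx; rewrite lexx ab].
have Sb : ubound S b by move=> t [/andP[]].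
have hS : has_sup S by split; [exists a|exists b].
pose c := sup S.
have ac : a <= c by apply: ub_le_sup aS; exists b.
have cb : c <= b by apply: ge_sup => //; exists a.
have acb : a <= c <= b by rewrite ac.
have /nbhs_ballP[e /= e0 ball_e] := Ploc c acb.
have [t [/andP[at_ tb] Pat] ct] := sup_adherent e0 hS.
have tc : t <= c by apply: ub_le_sup; [exists b|split=> //; rewrite at_].
have Pac : P a c.
  apply: (Ptr a t c) => //.
  have [|h _] := ball_e t; last by apply: h; rewrite at_.
  by rewrite /ball/= ger0_norm ?subr_ge0// ltrBlDl -ltrBlDr.
have [cb'|bc] := ltP c b; last by have <- : c = b by apply/eqP; rewrite eq_le cb.
pose s := Num.min b (c + e / 2).
have cs : c < s by rewrite lt_min cb' ltrDl divr_gt0.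
have sb : s <= b by rewrite ge_min lexx.
have sS : S s.
  split; first by rewrite sb (le_trans ac (ltW cs)).
  apply: (Ptr a c s) => //; first exact: ltW.
  have [|_ h] := ball_e s; last by apply: h; rewrite (ltW cs).
  rewrite /ball/= distrC gtr0_norm ?subr_gt0// ltrBlDl.
  have : s <= c + e / 2 by rewrite ge_min lexx orbT.
  by move=> /le_lt_trans; apply; rewrite ltrD2l ltr_pdivrMr// ltr_pMr// ltr1n.
have : s <= c by apply: ub_le_sup sS; exists b.
by rewrite leNgt cs.
Qed.

Section PolygonLength.
Context {R : realType} {M : nat}.
Implicit Types (g : R -> 'rV[R]_M) (a b c : R).

Lemma polygon_length_nil g a b : polygon_length g a b [::] = 0.
Proof. by rewrite /polygon_length big_geq. Qed.

Lemma polygon_length_cons g a b c s :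
  polygon_length g a b (c :: s) = enorm (g c - g a) + polygon_length g c b s.
Proof. by rewrite /polygon_length big_nat_recl. Qed.

Lemma polygon_length_cat g a b c s1 s2 : last a s1 = c ->
  polygon_length g a b (s1 ++ s2) = polygon_length g a c s1 + polygon_length g c b s2.
Proof.
elim: s1 a => [|x s1 IH] a /= h; first by rewrite h polygon_length_nil add0r.
by rewrite !polygon_length_cons IH// addrA.
Qed.

Lemma polygon_length_le g a b (K : R) s : itv_partition a b s ->
  (forall u v, a <= u -> u <= v -> v <= b -> enorm (g v - g u) <= K * (v - u)) ->
  polygon_length g a b s <= K * (b - a).
Proof.
elim: s a => [|c s IH] a.
  by move=> /itv_partition_nil ->; rewrite polygon_length_nil subrr mulr0.
move=> abs gK; have cbs := itv_partition_cons abs.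
have ac : a < c by case: abs => /andP[].
have cb := itv_partition_le cbs.
rewrite polygon_length_cons.
have -> : K * (b - a) = K * (c - a) + K * (b - c) by ring.
apply: lerD; first by apply: gK => //; exact: ltW.
by apply: IH => // u v cu; apply: gK; exact: le_trans (ltW ac) cu.
Qed.

End PolygonLength.

(** * Intrinsic metric and geodesics *)

Section CliqueSpace.
Context {R : realType} {M : nat} (cmp : rel 'I_M).
Implicit Types (p x y : 'rV[R]_M) (g h : R -> 'rV[R]_M) (a d : 'I_M -> R).

(** An orthant space is recovered from the pairs of axes that span a stratum, see
    [orthant_space_clique]; taking [i = j] in [adj] records which axes occur. *)
Definition clique_space : set 'rV[R]_M :=
  [set x : 'rV[R]_M | (forall i, 0 <= x 0 i) /\ adj cmp x x].

Local Notation X := clique_space.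

(** The consequence of continuity behind adjacency of nearby points. It covers both continuous paths
    and geodesics, whose definition gives only a Lipschitz bound. *)
Definition support_lsc (a b : R) h := forall t, a <= t <= b -> forall i, h t 0 i != 0 ->
  \forall s \near t, a <= s <= b -> h s 0 i != 0.

(** The support at [t] is contained in the support at every nearby [s], and the latter is a clique
    because [h s] lies in the space. *)
Lemma near_adj (a b : R) h t : support_lsc a b h ->
  (forall t, a <= t <= b -> X (h t)) -> a <= t <= b ->
  \forall s \near t, a <= s <= b -> adj cmp (h t) (h s) /\ adj cmp (h s) (h t).
Proof.
move=> hl hX tab.
have : \forall s \near t, forall i, h t 0 i != 0 -> a <= s <= b -> h s 0 i != 0.
  apply: (@filter_forall R 'I_M
    (fun i s => h t 0 i != 0 -> a <= s <= b -> h s 0 i != 0) (nbhs t)) => i.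
  have [h0|h0] := eqVneq (h t 0 i) 0.
    by apply: nearW.
  by apply: filterS (hl t tab i h0) => s hs _.
apply: filterS => s sub sab; have [_ ass] := hX s sab.
split=> i j hi hj; apply: ass => //; exact: sub.
Qed.

Lemma polygon_weaken c p x T T' : 0 <= c -> X x -> T <= T' ->
  polygon cmp c p x T -> polygon cmp c p x T'.
Proof.
move=> c0 [_ xx] TT' px; rewrite -[T'](subrKC T).
by apply: polygon_rcons px xx _ _; rewrite ?subr_ge0// subrr enorm0 mulr_ge0// subr_ge0.
Qed.

(** The allowance [w] is only superadditive: time left over when pieces are joined is spent by
    waiting at the end point. *)
Lemma path_polygon (c : R) (w : R -> R -> R) (a b : R) h : a <= b -> 0 <= c ->
  support_lsc a b h -> (forall t, a <= t <= b -> X (h t)) ->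
  (forall s t, a <= s -> s <= t -> t <= b ->
     0 <= w s t /\ enorm (h t - h s) <= c * w s t) ->
  (forall s t u, a <= s -> s <= t -> t <= u -> u <= b -> w s t + w t u <= w s u) ->
  polygon cmp c (h a) (h b) (w a b).
Proof.
move=> ab c0 hl hX hw wadd.
apply: (@segment_chain R (fun s t => polygon cmp c (h s) (h t) (w s t))) => //.
- move=> t /andP[at_ tb]; have [w0 _] := hw t t at_ (lexx t) tb.
  by apply: polygon_weaken (polygon_nil _ _ _) => //; apply: hX; rewrite at_.
- move=> s t u as_ st tu ub hst htu.
  apply: polygon_weaken (wadd s t u as_ st tu ub) (polygon_trans hst htu) => //.
  by apply: hX; rewrite ub (le_trans as_)// (le_trans st).
- move=> t tab; apply: filterS (near_adj hl hX tab) => s hs.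
  have /andP[at_ tb] := tab.
  split=> /andP[h1 h2].
    have [w0 we] := hw s t h1 h2 tb.
    by apply: polygon1 => //; apply hs; rewrite h1 (le_trans h2).
  have [w0 we] := hw t s at_ h1 h2.
  by apply: polygon1 => //; apply hs; rewrite h2 (le_trans at_).
Qed.

Lemma continuous_support_lsc (a b : R) h :
  {within `[a, b], continuous h} -> support_lsc a b h.
Proof.
move=> /subspace_continuousP ch t tab i hi.
have := ch t; rewrite /= in_itv/= => /(_ tab) hcv.
have hc := @cvg_coord R M R _ _ h (h t) i hcv.
have : \forall s \near within `[a, b] (nbhs t), h s 0 i != 0.
  have nb : nbhs (h t 0 i) [set y : R | y != 0].
    by apply: open_nbhs_nbhs; split=> //; exact: open_neq.
  exact: hc nb.
by rewrite near_withinE; apply: filterS => s + sab; apply; rewrite /= in_itv.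
Qed.

(** A fine enough partition has adjacent consecutive points, so a lower bound for polygons passes to
    all paths. *)
Lemma path_in_polygon x y g : path_in X x y g ->
  exists2 s, itv_partition 0 1 s & polygon cmp 1 x y (polygon_length g 0 1 s).
Proof.
move=> [cg <- <- gX].
apply: (@segment_chain R (fun s t => exists2 l, itv_partition s t l &
  polygon cmp 1 (g s) (g t) (polygon_length g s t l))) => //.
- by move=> t _; exists [::]; [split|rewrite polygon_length_nil; exact: polygon_nil].
- move=> s t u _ _ _ _ [l1 p1 q1] [l2 p2 q2].
  exists (l1 ++ l2); first exact: itv_partition_cat p1 p2.
  by case: p1 => _ /eqP lt; rewrite (polygon_length_cat _ _ _ lt); exact: polygon_trans q1 q2.
- move=> t t01.
  have gX' s : 0 <= s <= 1 -> X (g s) by move=> s01; apply: gX; rewrite in_itv.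
  apply: filterS (near_adj (continuous_support_lsc cg) gX' t01) => s hs.
  have seg u v : u <= v -> adj cmp (g u) (g v) -> exists2 l, itv_partition u v l &
      polygon cmp 1 (g u) (g v) (polygon_length g u v l).
    rewrite le_eqVlt => /predU1P[-> _|uv auv].
      by exists [::]; [split|rewrite polygon_length_nil; exact: polygon_nil].
    exists [:: v]; first exact: itv_partition1.
    rewrite polygon_length_cons polygon_length_nil addr0.
    by apply: polygon1 => //; rewrite ?enorm_ge0 ?mul1r.
  have /andP[t0 t1] := t01.
  split=> /andP[h1 h2]; apply: seg => //; apply hs.
    by rewrite h1 (le_trans h2).
  by rewrite h2 (le_trans t0).
Qed.

Lemma idist_eq x y (l : R) :
  (exists2 g, path_in X x y g &
     forall s, itv_partition 0 1 s -> polygon_length g 0 1 s <= l) ->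
  (forall T, polygon cmp 1 x y T -> l <= T) -> idist X x y = l.
Proof.
move=> [g gxy gl] lb; rewrite /idist.
suff -> : ereal_inf [set path_length g | g in path_in X x y] = l%:E by [].
apply/eqP; rewrite eq_le; apply/andP; split.
  apply: (@le_trans _ _ (path_length g)); first by apply: ereal_inf_lbound; exists g.
  by apply: ge_ereal_sup => _ [s sp <-]; rewrite lee_fin; exact: gl.
apply: le_ereal_inf_tmp => _ [h hxy <-].
have [s sp ps] := path_in_polygon hxy.
apply: (@le_trans _ _ (polygon_length h 0 1 s)%:E); first by rewrite lee_fin; exact: lb.
by apply: ereal_sup_ubound; exists s.
Qed.

End CliqueSpace.
Section Geodesics.
Context {R : realType} {M : nat} (cmp : rel 'I_M).
Hypothesis cmp_sym : symmetric cmp.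
Implicit Types (p x : 'rV[R]_M) (g : R -> 'rV[R]_M) (a d : 'I_M -> R).

Local Notation X := (@clique_space R M cmp).

Definition opt_schedule p x a d :=
  optimal (vweight p x) (vweight x p) (conflict cmp p x) a d.

Lemma opt_schedule_exists p x : exists a d, opt_schedule p x a d.
Proof. exact: optimal_exists (conflict_weights cmp p x). Qed.

Lemma vanishingC p x i : vanishing p x i -> vanishing x p i = false.
Proof. by rewrite /vanishing => /andP[_ ->]. Qed.

Lemma schedule0 p x a d : (forall i, 0 <= d i) -> schedule p x a d 0 = p.
Proof.
move=> d0; apply/rowP => i; rewrite mxE mul0r addr0 mulr0 subr0.
rewrite (max_idPr ler01) mulr1 mulr1 opprD addrA subrr add0r.
rewrite (max_idPl _) ?oppr_le0// mulr0.
by case: ifP => // _; case: ifP => // /andP[_ /eqP->].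
Qed.

Lemma schedule1 p x a d : (forall i, 0 <= a i) -> schedule p x a d 1 = x.
Proof.
move=> a0; apply/rowP => i; rewrite mxE mulr1 opprD addrA subrr add0r mulr0 subr0.
rewrite (max_idPl _) ?oppr_le0// mulr0 (max_idPr ler01) mulr1 mul1r subrKC.
by case: ifP => [/andP[_ /eqP->]//|_]; case: ifP.
Qed.

Lemma schedule_in p x a d t : X p -> X x -> feasible (conflict cmp p x) a d ->
  0 <= t <= 1 -> X (schedule p x a d t).
Proof.
move=> [p0 pp] [x0 xx] [a0 d0 ad] /andP[t0 t1].
have m0 (u : R) : 0 <= Num.max 0 u by rewrite le_max lexx.
split=> [i|i j].
  rewrite mxE; case: ifP => _; first by rewrite mulr_ge0.
  case: ifP => _; first by rewrite mulr_ge0.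
  have -> : p 0 i + t * (x 0 i - p 0 i) = (1 - t) * p 0 i + t * x 0 i by ring.
  by rewrite addr_ge0// mulr_ge0// subr_ge0.
have supp k : schedule p x a d t 0 k != 0 ->
    [\/ [/\ vanishing p x k & (1 + a k) * t < 1],
        [/\ vanishing x p k & (1 + d k) * (1 - t) < 1] | p 0 k != 0 /\ x 0 k != 0].
  have pos (u : R) : Num.max 0 (1 - u) != 0 -> u < 1.
    by apply: contraR; rewrite -leNgt -subr_le0 => h; rewrite (max_idPl h).
  rewrite mxE; have [vk|nvk] := ifPn.
    by rewrite mulf_eq0 negb_or => /andP[_ /pos]; constructor 1.
  have [vk|nvk'] := ifPn.
    by rewrite mulf_eq0 negb_or => /andP[_ /pos]; constructor 2.
  move=> h; constructor 3; move: nvk nvk' h; rewrite /vanishing !negb_and !negbK.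
  have [->|] := eqVneq (p 0 k) 0; have [->|] := eqVneq (x 0 k) 0 => //=.
  by rewrite subrr mulr0 addr0 eqxx.
(* If both coordinates were nonzero at time [t], then [a k * t < 1 - t] and [d l * (1 - t) < t],
   whose product contradicts [1 <= a k * d l]. *)
have cross k l : vanishing p x k -> (1 + a k) * t < 1 ->
    vanishing x p l -> (1 + d l) * (1 - t) < 1 -> cmp k l.
  move=> vk hk vl hl; apply: contraT => ckl.
  have akl : 1 <= a k * d l by apply: ad; rewrite /conflict vk vl.
  have h1 : a k * t < 1 - t by rewrite ltrBrDl; move: hk; rewrite mulrDl mul1r.
  have h2 : d l * (1 - t) < t.
    by move: hl; rewrite mulrDl mul1r -ltrBrDl opprB addrCA subrr addr0.
  have t1' : 0 < 1 - t by apply: le_lt_trans h1; rewrite mulr_ge0.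
  have t0' : 0 < t by apply: le_lt_trans h2; rewrite mulr_ge0// ltW.
  have h3 : (a k * t) * (d l * (1 - t)) < (1 - t) * t.
    by rewrite ltr_pM// mulr_ge0// ltW.
  have h4 : 1 * ((1 - t) * t) <= (a k * d l) * ((1 - t) * t).
    by rewrite ler_wpM2r// mulr_ge0// ltW.
  nra.
move=> /supp[[vi hi]|[vi hi]|[pi xi]] /supp[[vj hj]|[vj hj]|[pj xj]].
- by apply: pp; [case/andP: vi|case/andP: vj].
- exact: cross.
- by apply: pp => //; case/andP: vi.
- by rewrite cmp_sym; exact: cross.
- by apply: xx; [case/andP: vi|case/andP: vj].
- by apply: xx => //; case/andP: vi.
- by apply: pp => //; case/andP: vj.
- by apply: xx => //; case/andP: vj.
- exact: pp.
Qed.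

Lemma schedule_continuous p x a d : continuous (schedule p x a d).
Proof.
move=> t; apply: cvg_row => i; rewrite mxE; under eq_fun do rewrite mxE.
case: ifP => _.
  apply: cvgM; first exact: cvg_cst.
  apply: cvg_maxr; first exact: cvg_cst.
  by apply: cvgB; [exact: cvg_cst|apply: cvgM; [exact: cvg_cst|exact: cvg_id]].
case: ifP => _.
  apply: cvgM; first exact: cvg_cst.
  apply: cvg_maxr; first exact: cvg_cst.
  apply: cvgB; first exact: cvg_cst.
  apply: cvgM; first exact: cvg_cst.
  by apply: cvgB; [exact: cvg_cst|exact: cvg_id].
by apply: cvgD; [exact: cvg_cst|apply: cvgM; [exact: cvg_id|exact: cvg_cst]].
Qed.

(** The action used by coordinate [i] up to time [t]: a closed form for the integral of its squared
    speed. *)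
Definition spent p x a d t i :=
  if vanishing p x i then p 0 i ^+ 2 * (1 + a i) * Num.min 1 ((1 + a i) * t)
  else if vanishing x p i then
    x 0 i ^+ 2 * (1 + d i) * Num.max 0 (1 - (1 + d i) * (1 - t))
  else (x 0 i - p 0 i) ^+ 2 * t.

Lemma spent_total p x a d : (forall i, 0 <= a i) -> (forall i, 0 <= d i) ->
  \sum_i spent p x a d 1 i - \sum_i spent p x a d 0 i = action p x a d.
Proof.
move=> a0 d0; rewrite /action sqr_enorm /cost -sumrB -!big_split/=.
apply: eq_bigr => i _; rewrite /spent /vweight !mxE !mulr1 !mulr0 subrr mulr0 subr0.
rewrite (min_idPl _) ?lerDl// (min_idPr ler01) (max_idPr ler01) (max_idPl _); last first.
  by rewrite mulr1 opprD addrA subrr add0r oppr_le0.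
case: ifPn => [vi|nvi].
  rewrite (vanishingC vi); case/andP: vi => _ /eqP->; ring.
case: ifPn => [/andP[_ /eqP->]|_]; ring.
Qed.

(** A coordinate either rests or moves at one fixed speed, so its increment is at most that speed
    times [t - s]; multiplying by the increment itself gives the bound by time times action. *)
Lemma schedule_step p x a d s t i : (forall i, 0 <= a i) -> (forall i, 0 <= d i) ->
  s <= t -> spent p x a d s i <= spent p x a d t i /\
  (schedule p x a d t 0 i - schedule p x a d s 0 i) ^+ 2 <=
    (t - s) * (spent p x a d t i - spent p x a d s i).
Proof.
move=> a0 d0 st; rewrite /spent !mxE.
have ts0 : 0 <= t - s by rewrite subr_ge0.
have key (k u v z : R) : 0 <= v - u -> v - u <= k * (t - s) -> 0 <= k ->
    z ^+ 2 * k * u <= z ^+ 2 * k * v /\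
    (z * (v - u)) ^+ 2 <= (t - s) * (z ^+ 2 * k * v - z ^+ 2 * k * u).
  move=> uv vk k0; split.
    by apply: ler_wpM2l; [rewrite mulr_ge0 ?sqr_ge0|rewrite -subr_ge0].
  have -> : (t - s) * (z ^+ 2 * k * v - z ^+ 2 * k * u) =
     z ^+ 2 * ((v - u) * (k * (t - s))) by ring.
  by rewrite exprMn ler_wpM2l ?sqr_ge0// expr2 ler_wpM2l.
case: ifP => _.
  have k0 : 0 <= 1 + a i by rewrite addr_ge0.
  have ka : (1 + a i) * s <= (1 + a i) * t by rewrite ler_wpM2l.
  have mE (u : R) : Num.max 0 (1 - u) = 1 - Num.min 1 u.
    case: (leP u 1) => h; first by rewrite (max_idPr _) ?subr_ge0.
    by rewrite subrr (max_idPl _)// subr_le0 ltW.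
  rewrite !mE.
  have -> : p 0 i * (1 - Num.min 1 ((1 + a i) * t)) - p 0 i * (1 - Num.min 1 ((1 + a i) * s))
    = - (p 0 i * (Num.min 1 ((1 + a i) * t) - Num.min 1 ((1 + a i) * s))) by ring.
  rewrite sqrrN; apply: key => //.
    by rewrite subr_ge0 le_min ge_min lexx/= ge_min ka orbT.
  rewrite /Num.min; case: ltP => h1; case: ltP => h2; nra.
case: ifP => _.
  have k0 : 0 <= 1 + d i by rewrite addr_ge0.
  have ka : (1 + d i) * s <= (1 + d i) * t by rewrite ler_wpM2l.
  rewrite -mulrBr; apply: key => //.
    rewrite subr_ge0 ge_max le_max lexx/= le_max; apply/orP; right; nra.
  rewrite /Num.max; case: ltP => h1; case: ltP => h2; nra.
have := key 1 s t (x 0 i - p 0 i); rewrite mul1r !mulr1 => -[]// h1 h2; split=> //.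
have -> : p 0 i + t * (x 0 i - p 0 i) - (p 0 i + s * (x 0 i - p 0 i)) =
  (x 0 i - p 0 i) * (t - s) by ring.
exact: h2.
Qed.

Section Optimal.
Variables (p x : 'rV[R]_M) (a d : 'I_M -> R).
Hypotheses (Xp : X p) (Xx : X x) (opt : opt_schedule p x a d).

Let D := Num.sqrt (action p x a d).

Let a0 i : 0 <= a i. Proof. by case: opt => -[]. Qed.
Let d0 i : 0 <= d i. Proof. by case: opt => -[]. Qed.

Lemma action_ge0 : 0 <= action p x a d.
Proof.
by rewrite addr_ge0 ?sqr_ge0// (cost_ge0 (conflict_weights cmp p x) opt.1).
Qed.

Let D0 : 0 <= D. Proof. exact: sqrtr_ge0. Qed.
Let DD : D ^+ 2 = action p x a d. Proof. by rewrite sqr_sqrtr// action_ge0. Qed.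

Lemma polygon_ge T : polygon cmp 1 p x T -> D <= T.
Proof.
move=> px; have T0 := polygon_time_ge0 px.
have [T1|T1] := eqVneq T 0.
  have := polygon_dist_le ler01 px; rewrite mul1r T1 => xp.
  have {}xp : x = p.
    apply/rowP => i; apply/eqP; rewrite -subr_eq0 -sqrf_eq0 eq_le sqr_ge0 andbT.
    have := coord_le_enorm (x - p) i; rewrite !mxE => /le_trans; apply.
    by have /eqP-> : enorm (x - p) == 0; [rewrite eq_le xp enorm_ge0|rewrite expr0n].
  have v0 i : vanishing p p i = false by rewrite /vanishing; case: eqP.
  suff -> : D = 0 by [].
  apply/eqP; rewrite -sqrf_eq0 DD /action /cost xp subrr enorm0 expr0n add0r.
  by rewrite !big1 ?addr0// => i _; rewrite /vweight v0 mul0r.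
have T2 : 0 < T by rewrite lt0r T1.
(* The first polygon is trivial, so [r = 0] and the deviation term disappears. *)
have [|a' [d' [fe]]] := polygon_action ler01 T2 (polygon_nil cmp 1 p) px.
  by move=> i /andP[pi _]; rewrite mul0r lt0r sqr_ge0 sqrf_eq0 pi.
rewrite invr0 mulr0 mul0r addr0 add0r expr1n mul1r => act.
rewrite -(@ler_pXn2r _ 2) ?nnegrE// DD; apply: le_trans act.
by rewrite lerD2l; exact: opt.2.
Qed.

Let gam := schedule p x a d.
Let E t := \sum_i spent p x a d t i.

Let Emono s t : s <= t -> E s <= E t.
Proof. by move=> st; apply: ler_sum => i _; have [] := schedule_step p x i a0 d0 st. Qed.

Let gamE s t : s <= t -> enorm (gam t - gam s) ^+ 2 <= (t - s) * (E t - E s).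
Proof.
move=> st; rewrite sqr_enorm -sumrB mulr_sumr; apply: ler_sum => i _.
by have [_] := schedule_step p x i a0 d0 st; rewrite !mxE.
Qed.

Let gam0 : gam 0 = p. Proof. exact: schedule0. Qed.
Let gam1 : gam 1 = x. Proof. exact: schedule1. Qed.
Let gamX t : 0 <= t <= 1 -> X (gam t). Proof. exact: schedule_in Xp Xx opt.1. Qed.

Let gam_polygon (w : R -> R -> R) s t : 0 <= s -> s <= t -> t <= 1 ->
  (forall s t, s <= t -> 0 <= w s t /\ enorm (gam t - gam s) <= w s t) ->
  (forall s t u, s <= t -> t <= u -> w s t + w t u <= w s u) ->
  polygon cmp 1 (gam s) (gam t) (w s t).
Proof.
move=> s0 st t1 hw wadd; apply: path_polygon => //.
- exact/continuous_support_lsc/continuous_subspaceT/schedule_continuous.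
- by move=> u /andP[su ut]; apply: gamX; rewrite (le_trans s0)// (le_trans ut).
- by move=> u v _ uv _; rewrite mul1r; exact: hw.
- by move=> u v z _ uv vz _; exact: wadd.
Qed.

(* The pieces before s, between s and t, and after t have lengths whose squares
   are at most duration times action, while the whole action is D ^+ 2: by the
   equality case of Cauchy-Schwarz the action is spent at constant rate. *)
Let Econst s t : 0 <= s -> s <= t -> t <= 1 -> E t - E s = (t - s) * D ^+ 2.
Proof.
move=> s0 st t1.
(* By [cauchy_add] this allowance is superadditive, as [path_polygon] requires. *)
pose w s t := Num.sqrt ((t - s) * (E t - E s)).
have w2 u v : u <= v -> w u v ^+ 2 = (v - u) * (E v - E u).
  by move=> uv; rewrite sqr_sqrtr// mulr_ge0// subr_ge0 ?Emono.
have w0 u v : 0 <= w u v by exact: sqrtr_ge0.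
have wadd2 u v u' v' : u <= v -> u' <= v' ->
    (w u v + w u' v') ^+ 2 <= ((v - u) + (v' - u')) * ((E v - E u) + (E v' - E u')).
  by move=> uv uv'; apply: cauchy_add; rewrite ?subr_ge0 ?Emono// w2.
have hw u v : u <= v -> 0 <= w u v /\ enorm (gam v - gam u) <= w u v.
  by move=> uv; split=> //; rewrite -(@ler_pXn2r _ 2) ?nnegrE ?enorm_ge0// w2// gamE.
have wadd u v z : u <= v -> v <= z -> w u v + w v z <= w u z.
  move=> uv vz; rewrite -(@ler_pXn2r _ 2) ?nnegrE ?addr_ge0// w2 ?(le_trans uv)//.
  apply: (le_trans (wadd2 _ _ _ _ uv vz)).
  by rewrite le_eqVlt; apply/orP; left; apply/eqP; ring.
have h1 : 0 <= 1 :> R by exact: ler01.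
have s1 : s <= 1 by exact: le_trans t1.
have t0 : 0 <= t by exact: le_trans st.
have := polygon_trans (polygon_trans (gam_polygon (lexx 0) s0 s1 hw wadd)
  (gam_polygon s0 st t1 hw wadd)) (gam_polygon t0 t1 (lexx 1) hw wadd).
rewrite gam0 gam1 => /polygon_ge DL.
have E01 : E 1 - E 0 = D ^+ 2 by rewrite DD; exact: spent_total.
pose v := w 0 s + w t 1; have v0 : 0 <= v by rewrite addr_ge0.
pose b := t - s; pose e := E t - E s.
have v2 : v ^+ 2 <= (1 - b) * (D ^+ 2 - e).
  apply: (le_trans (wadd2 _ _ _ _ s0 t1)); rewrite -E01 /b /e.
  by rewrite le_eqVlt; apply/orP; left; apply/eqP; ring.
have u2 : w s t ^+ 2 = b * e by exact: w2.
have {}DL : D <= w s t + v by rewrite /v addrA [w s t + _]addrC.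
have b0 : 0 <= b by rewrite subr_ge0.
have b1 : b <= 1 by rewrite /b lerBlDr (le_trans t1)// lerDl.
have e0 : 0 <= e by rewrite subr_ge0 Emono.
have e1 : e <= D ^+ 2 by rewrite -E01 /e lerB// Emono.
have D2 : D ^+ 2 <= (w s t + v) ^+ 2 by rewrite lerXn2r// nnegrE addr_ge0.
have u0 := w0 s t.
set u := w s t in u2 D2 u0 *.
(* Expanding [D ^+ 2 <= (u + v) ^+ 2] bounds [b * (D ^+ 2 - e) + e * (1 - b)] by twice [u * v],
   hence by twice the geometric mean of its two terms. So the terms are equal, which means
   [e = b * D ^+ 2]. *)
have K0 : 0 <= b * (D ^+ 2 - e) + e * (1 - b).
  by rewrite addr_ge0// mulr_ge0// subr_ge0.
have K1 : b * (D ^+ 2 - e) + e * (1 - b) <= 2 * (u * v).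
  have : (u + v) ^+ 2 = u ^+ 2 + v ^+ 2 + 2 * (u * v) by ring.
  lra.
have K2 : (b * (D ^+ 2 - e) + e * (1 - b)) ^+ 2 <= (2 * (u * v)) ^+ 2.
  by rewrite lerXn2r// nnegrE (le_trans K0).
have K3 : (2 * (u * v)) ^+ 2 <= 4 * ((b * e) * ((1 - b) * (D ^+ 2 - e))).
  have -> : (2 * (u * v)) ^+ 2 = 4 * (u ^+ 2 * v ^+ 2) by ring.
  by rewrite ler_wpM2l// u2 ler_wpM2l// mulr_ge0.
have K4 : (b * (D ^+ 2 - e) - e * (1 - b)) ^+ 2 <= 0.
  have -> : (b * (D ^+ 2 - e) - e * (1 - b)) ^+ 2 =
     (b * (D ^+ 2 - e) + e * (1 - b)) ^+ 2 - 4 * ((b * e) * ((1 - b) * (D ^+ 2 - e))) by ring.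
  by rewrite subr_le0; exact: le_trans K2 K3.
have : (b * (D ^+ 2 - e) - e * (1 - b)) ^+ 2 == 0 by rewrite eq_le K4 sqr_ge0.
by rewrite sqrf_eq0 => /eqP K5; rewrite -/e -/b; lra.
Qed.

Lemma schedule_lipschitz s t : 0 <= s -> s <= t -> t <= 1 ->
  enorm (schedule p x a d t - schedule p x a d s) <= D * (t - s).
Proof.
move=> s0 st t1; have ts : 0 <= t - s by rewrite subr_ge0.
rewrite -(@ler_pXn2r _ 2) ?nnegrE ?enorm_ge0 ?mulr_ge0//.
apply: (le_trans (gamE st)); rewrite Econst//.
by rewrite le_eqVlt; apply/orP; left; apply/eqP; ring.
Qed.

(** The schedule itself gives the upper bound, by constant speed. A shorter polygon between the two
    points, completed by the outer pieces of the schedule, would join [p] to [x] with length below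
    [D]. *)
Lemma idist_schedule s t : 0 <= s <= 1 -> 0 <= t <= 1 ->
  idist X (gam s) (gam t) = `|s - t| * D.
Proof.
move=> /andP[s0 s1] /andP[t0 t1].
have lip u v : 0 <= u <= 1 -> 0 <= v <= 1 -> enorm (gam v - gam u) <= D * `|v - u|.
  move=> /andP[u0 u1] /andP[v0 v1]; have [uv|/ltW vu] := leP u v.
    by rewrite ger0_norm ?subr_ge0//; exact: schedule_lipschitz.
  by rewrite enorm_sym distrC ger0_norm ?subr_ge0//; exact: schedule_lipschitz.
have between (z : R) : 0 <= z <= 1 -> 0 <= s + z * (t - s) <= 1.
  by move=> /andP[z0 z1]; apply/andP; split; nra.
apply: (idist_eq (cmp := cmp)).
  exists (fun z => gam (s + z * (t - s))).
    split; rewrite ?mul0r ?addr0 ?mul1r ?subrKC//.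
      apply: continuous_subspaceT => z.
      have hc : s + u * (t - s) @[u --> z] --> s + z * (t - s).
        by apply: cvgD; [exact: cvg_cst|apply: cvgM; [exact: cvg_id|exact: cvg_cst]].
      exact: (cvg_comp _ gam hc (@schedule_continuous p x a d _)).
    by move=> z; rewrite in_itv/= => /between; exact: gamX.
  move=> l /polygon_length_le; rewrite -[leRHS]mulr1 -[X in _ * X](subr0 1); apply.
  move=> u v u0 uv v1; apply: (le_trans (lip _ _ _ _)); try apply: between.
  - by rewrite u0 (le_trans uv).
  - by rewrite v1 (le_trans u0).
  have -> : s + v * (t - s) - (s + u * (t - s)) = (t - s) * (v - u) by ring.
  by rewrite normrM (ger0_norm (x := v - u)) ?subr_ge0// mulrA [D * _]mulrC distrC.
move=> T; wlog st : s t s0 s1 t0 t1 {lip between} / s <= t => [wl|].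
  have [st|/ltW ts] := leP s t; first exact: wl.
  by move=> /(polygon_sym cmp_sym); rewrite distrC; exact: wl.
have piece u v : 0 <= u -> u <= v -> v <= 1 -> polygon cmp 1 (gam u) (gam v) (D * (v - u)).
  move=> u0 uv v1; apply: (path_polygon (w := fun u v => D * (v - u))) => //.
  - exact/continuous_support_lsc/continuous_subspaceT/schedule_continuous.
  - by move=> z /andP[uz zv]; apply: gamX; rewrite (le_trans u0)// (le_trans zv).
  - move=> y z uy yz zv; rewrite mul1r mulr_ge0 ?subr_ge0//; split=> //.
    by apply: schedule_lipschitz; rewrite ?(le_trans u0)// (le_trans zv).
  - by move=> y z z' _ _ _ _; rewrite -mulrDr addrC addrA subrK.
move=> sT.
have := polygon_trans (polygon_trans (piece 0 s (lexx 0) s0 s1) sT) (piece t 1 t0 t1 (lexx 1)).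
rewrite gam0 gam1 => /polygon_ge; rewrite distrC ger0_norm ?subr_ge0// => h.
by rewrite mulrC; move: h; rewrite !mulrBr mulr1 mulr0 subr0; lra.
Qed.

Lemma idist_action : idist X p x = D.
Proof.
have := @idist_schedule 0 1; rewrite gam0 gam1 sub0r normrN1 mul1r; apply.
  by rewrite lexx ler01.
by rewrite ler01 lexx.
Qed.

Lemma schedule_geodesic : geodesic X p x gam.
Proof.
split=> //.
move=> s t; rewrite !in_itv/= => s01 t01.
by rewrite idist_schedule// idist_action.
Qed.

End Optimal.

Lemma enorm_le_idist p x : X p -> X x -> enorm (x - p) <= idist X p x.
Proof.
move=> Xp Xx; have [a [d opt]] := opt_schedule_exists p x.
rewrite (idist_action Xp Xx opt).
rewrite -(@ler_pXn2r _ 2) ?nnegrE ?enorm_ge0 ?sqrtr_ge0// (sqr_sqrtr (action_ge0 opt)).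
by rewrite /action lerDl (cost_ge0 (conflict_weights cmp p x) opt.1).
Qed.

(** The geodesic is a polygon of speed [D] through [g r], so [polygon_action] bounds an action plus
    the deviation of [g r] by [D ^+ 2], the minimal action. Hence the deviation is 0, the pair
    obtained is optimal, and it agrees with [a, d] wherever the schedule depends on it. *)
Lemma geodesic_unique p x a d g r : X p -> X x -> opt_schedule p x a d ->
  geodesic X p x g -> 0 < r -> r < 1 ->
  (forall i, vanishing p x i -> r * action p x a d < p 0 i ^+ 2) ->
  g r = schedule p x a d r.
Proof.
move=> Xp Xx opt [g0 g1 gX gd] r0 r1 rsmall.
set D := Num.sqrt (action p x a d).
have D0 : 0 <= D by exact: sqrtr_ge0.
have DD : D ^+ 2 = action p x a d by rewrite sqr_sqrtr// (action_ge0 opt).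
have lip s t : 0 <= s -> s <= t -> t <= 1 -> enorm (g t - g s) <= D * (t - s).
  move=> s0 st t1.
  have s01 : s \in `[0, 1] by rewrite in_itv/= s0 (le_trans st).
  have t01 : t \in `[0, 1] by rewrite in_itv/= t1 (le_trans s0).
  apply: (le_trans (enorm_le_idist (gX _ s01) (gX _ t01))).
  by rewrite gd// (idist_action Xp Xx opt) -/D distrC ger0_norm ?subr_ge0// mulrC.
have lip' s t : 0 <= s <= 1 -> 0 <= t <= 1 -> enorm (g t - g s) <= D * `|t - s|.
  move=> /andP[s0 s1] /andP[t0 t1]; have [st|/ltW ts] := leP s t.
    by rewrite ger0_norm ?subr_ge0//; exact: lip.
  by rewrite enorm_sym distrC ger0_norm ?subr_ge0//; exact: lip.
have lsc u v : 0 <= u -> v <= 1 -> support_lsc u v g.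
  move=> u0 v1 t /andP[ut tv] i gi.
  have t01 : 0 <= t <= 1 by rewrite (le_trans u0 ut) (le_trans tv v1).
  (* [D] may be 0, hence the denominator [D + 1]. *)
  have e0 : 0 < `|g t 0 i| / (D + 1) by rewrite divr_gt0 ?normr_gt0// ltr_wpDl.
  near=> s => /andP[us sv].
  have s01 : 0 <= s <= 1 by rewrite (le_trans u0 us) (le_trans sv v1).
  have st : `|s - t| < `|g t 0 i| / (D + 1).
    by rewrite distrC; near: s; exact: nbhsx_ballx.
  apply: contraTneq (lip' s t s01 t01) => gs; rewrite -ltNge.
  have h1 : D * `|t - s| < `|g t 0 i|.
    apply: (@le_lt_trans _ _ ((D + 1) * `|s - t|)).
      by rewrite distrC ler_wpM2r// lerDl.
    by rewrite mulrC -ltr_pdivlMr// ltr_wpDl.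
  apply: (lt_le_trans h1).
  have := coord_le_enorm (g t - g s) i; rewrite !mxE gs subr0 -real_normK ?num_real//.
  by rewrite ler_pXn2r// nnegrE ?enorm_ge0.
have piece u v : 0 <= u -> u <= v -> v <= 1 -> polygon cmp D (g u) (g v) (v - u).
  move=> u0 uv v1; apply: (path_polygon (w := fun u v => v - u)) => //.
  - exact: lsc.
  - by move=> z /andP[uz zv]; apply: gX; rewrite in_itv/= (le_trans u0)// (le_trans zv).
  - move=> y z uy yz zv; rewrite subr_ge0 yz; split=> //.
    by apply: lip; rewrite ?(le_trans u0)// (le_trans zv).
  - by move=> y z z' _ _ _ _; rewrite addrC addrA subrK.
have p1 := piece 0 r (lexx 0) (ltW r0) (ltW r1).
have p2 := piece r 1 (ltW r0) (ltW r1) (lexx 1).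
rewrite g0 subr0 in p1; rewrite g1 in p2.
have r1' : 0 < 1 - r by rewrite subr_gt0.
have [|a' [d' [fe]]] := polygon_action D0 r1' p1 p2.
  by move=> i vi; rewrite subrKC mulr1 DD; exact: rsmall.
rewrite subrKC divr1 expr1n mulr1 DD => act.
have mn := opt.2 a' d' fe.
set dev := \sum_i _ in act.
have dev0 : 0 <= dev by apply: sumr_ge0 => i _; exact: sqr_ge0.
have rdev0 : 0 <= 1 / r * dev by rewrite mulr_ge0 ?divr_ge0// ltW.
have opt' : opt_schedule p x a' d'.
  split=> // a'' d'' fe''; apply: le_trans (opt.2 _ _ fe'').
  by move: act; rewrite /action; lra.
have {}dev0 : dev = 0.
  have : 1 / r * dev <= 0 by move: act; rewrite /action; lra.
  rewrite pmulr_rle0 ?divr_gt0// => h; apply/eqP; by rewrite eq_le h.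
apply/rowP => i; transitivity (schedule p x a' d' r 0 i).
  apply/eqP; rewrite -subr_eq0 -sqrf_eq0; apply/eqP.
  by move: dev0 => /psumr_eq0P; apply => // j _; exact: sqr_ge0.
have we := conflict_weights cmp p x.
have we' : weights (vweight x p) (vweight p x) (fun i j => conflict cmp p x j i).
  by have [W0 Y0 eWY] := we; split=> // k l /eWY[].
rewrite !mxE; case: ifP => vi; first by rewrite (optimal_unique we opt' opt) ?vweight_gt0.
case: ifP => // vi'.
by rewrite (optimal_unique we' (optimal_sym opt') (optimal_sym opt)) ?vweight_gt0.
Unshelve. all: by end_near. Qed.

Definition initial_velocity p x a : 'rV[R]_M :=
  \row_i if vanishing p x i then - ((1 + a i) * p 0 i)
         else if vanishing x p i && [exists j, conflict cmp p x j i] then 0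
         else x 0 i - p 0 i.

(** Before the first vanishing, and before the first delayed appearance, the schedule is affine, so
    the difference quotient is constant for small times. *)
Lemma log_mapE p x a d : X p -> X x -> opt_schedule p x a d ->
  log_map X p x = initial_velocity p x a.
Proof.
move=> Xp Xx opt; rewrite /log_map.
have : geodesic X p x (get (geodesic X p x)).
  by apply: getPex; exists (schedule p x a d); exact: schedule_geodesic.
set g := get _ => gg; apply: cvg_lim; first exact: norm_hausdorff.
have [[a0 d0 ad] mn] := opt.
have act0 := action_ge0 opt.
have A1 : 0 < action p x a d + 1 by rewrite ltr_wpDl.
have small : \forall r \near (0 : R)^'+, forall i, vanishing p x i ->
   r * action p x a d < p 0 i ^+ 2 /\ (1 + a i) * r < 1.
  apply: filter_forall => i; have [vi|nvi] := boolP (vanishing p x i); last first.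
    by apply: nearW.
  have pi : 0 < p 0 i ^+ 2 by rewrite lt0r sqr_ge0 sqrf_eq0 andbT; case/andP: vi.
  near=> r => _; split.
    apply: (@le_lt_trans _ _ (r * (action p x a d + 1))).
      by rewrite ler_wpM2l ?lerDl//.
    rewrite -ltr_pdivlMr//; near: r; apply: nbhs_right_lt; exact: divr_gt0.
  rewrite mulrC -ltr_pdivlMr ?ltr_wpDr//.
  by near: r; apply: nbhs_right_lt; rewrite divr_gt0// ltr_wpDr.
have small' : \forall r \near (0 : R)^'+, forall i,
    [exists j, conflict cmp p x j i] -> 1 <= (1 + d i) * (1 - r).
  apply: filter_forall => i.
  have [/existsP[j cji]|nc] := boolP [exists j, conflict cmp p x j i]; last first.
    by apply: nearW.
  have di : 0 < d i.
    by rewrite lt0r d0 andbT; apply: contraTneq (ad _ _ cji) => ->; rewrite mulr0 ler10.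
  have di1 : 0 < 1 + d i by rewrite ltr_wpDr.
  near=> r => _; rewrite -ler_pdivrMl// mulr1 lerBrDl -lerBrDr.
  near: r; apply: nbhs_right_le.
  by rewrite subr_gt0 invf_lt1// ltrDl.
apply: cvg_near_cst; near=> r.
have r0 : 0 < r by near: r; exact: nbhs_right_gt.
have r1 : r < 1 by near: r; apply: nbhs_right_lt.
have sm : forall i, vanishing p x i -> r * action p x a d < p 0 i ^+ 2 /\ (1 + a i) * r < 1.
  by near: r.
have sm' : forall i, [exists j, conflict cmp p x j i] -> 1 <= (1 + d i) * (1 - r).
  by near: r.
rewrite (geodesic_unique Xp Xx opt gg)//; last by move=> i /sm[].
have rn : r != 0 by rewrite gt_eqF.
apply/rowP => i; rewrite !mxE; case: ifP => vi.
  have [_ /ltW ar] := sm i vi; rewrite -subr_ge0 in ar; rewrite (max_idPr ar).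
  by field.
case: ifP => vj /=; last by field.
have /andP[_ /eqP pi] := vj; rewrite pi subr0; case: ifPn => ex.
  have := sm' i ex; rewrite -subr_le0 => /max_idPl->.
  by rewrite mulr0 mulr0.
(* A gained coordinate without conflict appears at once, so it moves linearly from time 0. *)
have d00 : d i = 0.
  apply/eqP; rewrite eq_le d0 andbT.
  have we' : weights (vweight x p) (vweight p x) (fun i j => conflict cmp p x j i).
    by have [W0 Y0 eWY] := conflict_weights cmp p x; split=> // k l /eWY[].
  apply: (optimal_min_le we' (optimal_sym opt)); rewrite ?vweight_gt0// => j cji.
  by case/negP: ex; apply/existsP; exists j.
rewrite d00 addr0 mul1r subKr (max_idPr (ltW r0)).
by field.
Unshelve. all: by end_near. Qed.

End Geodesics.
(** * Limit of the logarithm at a boundary point *)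

Lemma cvg_bigmaxr {R : realType} {T I : Type} (F : set_system T) {FF : Filter F}
    (r : seq I) (P : pred I) (f : I -> T -> R) (l : I -> R) (c : R) :
  (forall i, P i -> f i x @[x --> F] --> l i) ->
  \big[Num.max/c]_(i <- r | P i) f i x @[x --> F] -->
    \big[Num.max/c]_(i <- r | P i) l i.
Proof.
move=> fl; elim: r => [|i r IH].
  by rewrite big_nil; under eq_fun do rewrite big_nil; exact: cvg_cst.
rewrite big_cons; under eq_fun do rewrite big_cons.
by have [Pi|//] := boolP (P i); apply: cvg_maxr => //; exact: fl.
Qed.

Lemma cvg_bigminr {R : realType} {T I : Type} (F : set_system T) {FF : Filter F}
    (r : seq I) (P : pred I) (f : I -> T -> R) (l : I -> R) (g : T -> R) (c : R) :
  g x @[x --> F] --> c ->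
  (forall i, P i -> f i x @[x --> F] --> l i) ->
  \big[Num.min/g x]_(i <- r | P i) f i x @[x --> F] -->
    \big[Num.min/c]_(i <- r | P i) l i.
Proof.
move=> gc fl; elim: r => [|i r IH].
  by rewrite big_nil; under eq_fun do rewrite big_nil.
rewrite big_cons; under eq_fun do rewrite big_cons.
by have [Pi|//] := boolP (P i); apply: cvg_minr => //; exact: fl.
Qed.

Section ProgramLimits.
Context {R : realType} {n : nat}.
Implicit Types (W Y a d : 'I_n -> R) (e : rel 'I_n).

(** Every denominator contains the weight of [i], so it stays positive although other weights may
    tend to 0. *)
Lemma cvg_maxmin {T : Type} (F : set_system T) {FF : Filter F}
    (W : T -> 'I_n -> R) W0 Y e i :
  (forall k, 0 <= W0 k) -> 0 < W0 i ->
  (forall k, W s k @[s --> F] --> W0 k) ->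
  maxmin (W s) Y e i @[s --> F] --> maxmin W0 Y e i.
Proof.
move=> W0p W0i Wc.
have ratio (L U : {set 'I_n} * {set 'I_n}) : i \in L.1 -> i \in U.1 ->
    set_ratio (W s) Y L U @[s --> F] --> set_ratio W0 Y L U.
  move=> iL iU; apply: cvgM; first exact: cvg_cst.
  apply: cvgV; last by apply: cvg_sumr => k _; exact: Wc.
  by rewrite gt_eqF// (bigD1 i) ?inE ?iL//= ltr_wpDr// sumr_ge0.
apply: cvg_bigmaxr => L /andP[iL _]; apply: cvg_bigminr.
  by apply: ratio => //; rewrite finset.in_setT.
by move=> U /andP[iU _]; exact: ratio.
Qed.

(** Substituting [a / k] and [k * d] preserves all products and multiplies the cost by [k]. *)
Lemma optimal_scale W Y e a d (k : R) : 0 < k -> optimal W Y e a d ->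
  optimal (fun i => k ^+ 2 * W i) Y e (fun i => a i / k) (fun j => k * d j).
Proof.
move=> k0 [[a0 d0 ad] mn].
have costE a' d' : cost (fun i => k ^+ 2 * W i) Y a' d' =
    k * cost W Y (fun i => k * a' i) (fun j => d' j / k).
  rewrite /cost mulrDr !mulr_sumr; congr (_ + _); apply: eq_bigr => i _; first by ring.
  by field; rewrite gt_eqF.
split=> [|a' d' [a'0 d'0 ad']].
  split=> [i|j|i j /ad h]; [by rewrite divr_ge0// ltW|by rewrite mulr_ge0// ltW|].
  by have -> : a i / k * (k * d j) = a i * d j by field; rewrite gt_eqF.
rewrite !costE ler_pM2l//.
have -> : cost W Y (fun i => k * (a i / k)) (fun j => k * d j / k) = cost W Y a d.
  by congr (_ + _); apply: eq_bigr => i _; congr (_ * _); field; rewrite gt_eqF.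
apply: mn; split=> [i|j|i j /ad' h]; [by rewrite mulr_ge0// ltW|by rewrite divr_ge0// ltW|].
by have -> : k * a' i * (d' j / k) = a' i * d' j by field; rewrite gt_eqF.
Qed.

(** A bounded cost limits [a i], so a conflict with a coordinate of fixed weight keeps [d j] away
    from 0. *)
Lemma feasible_lower W Y e a d (C : R) i j : weights W Y e -> feasible e a d ->
  cost W Y a d <= C -> e i j -> W i <= C * d j.
Proof.
move=> we fe cC eij; have [a0 d0 ad] := fe; have [W0 _ _] := we.
apply: (@le_trans _ _ (W i * (a i * d j))); first by rewrite ler_peMr// ad.
by rewrite mulrA ler_wpM2r// (le_trans (cost_gel i we fe)).
Qed.

Lemma optimal_cost_le W Y e a d : optimal W Y e a d ->
  cost W Y a d <= \sum_i W i + \sum_j Y j.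
Proof.
move=> [_ mn]; have -> : \sum_i W i + \sum_j Y j = cost W Y (fun=> 1) (fun=> 1).
  by congr (_ + _); apply: eq_bigr => i _; rewrite mulr1.
by apply: mn; split=> // *; rewrite mulr1.
Qed.

End ProgramLimits.

Section PsiLimit.
Context {R : realType} {M : nat} (cmp : rel 'I_M).
Hypothesis cmp_sym : symmetric cmp.
Local Notation X := (@clique_space R M cmp).
Variables (E F : {set 'I_M}) (x xs : 'rV[R]_M).
Hypotheses (EF0 : [disjoint E & F]%B) (EFX : orthant (E :|: F) `<=` X)
  (Xx : X x) (xsE : orthant E xs).

Let disjEF i : i \in E -> i \in F -> False.
Proof. by move=> iE iF; have /pred0P/(_ i) := EF0; rewrite /= iE iF. Qed.

(* The vanishing coordinates, the weights and the conflicts of the program from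
   xs + t *: w to x do not depend on the small parameter t > 0. *)
Definition lost i := (i \in E :|: F) && (x 0 i == 0).
Definition gained j := (j \notin E :|: F) && (x 0 j != 0).
Definition clash : rel 'I_M := fun i j => [&& lost i, gained j & ~~ cmp i j].
Definition gain_weight j : R := if gained j then x 0 j ^+ 2 else 0.
Definition base_weight i : R := if lost i then xs 0 i ^+ 2 else 0.

(* j in [late] is compatible with all of E, so it appears at time 0 in the limit
   t -> 0; i in [early] must vanish before such a j, so its time tends to 0. *)
Definition late : {set 'I_M} := [set j | gained j && [forall i in E, ~~ clash i j]]%SET.
Definition early : {set 'I_M} := [set i in F | [exists j in late, clash i j]]%SET.

Definition link_weight (w : 'rV[R]_M) i : R := if i \in early then w 0 i ^+ 2 else 0.
Definition late_weight j : R := if j \in late then x 0 j ^+ 2 else 0.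
Definition link_clash : rel 'I_M := fun i j => clash i j && (j \in late).

(** The square roots are the optimal values in closed form; [w] enters only the [early] branch. *)
Definition Psi_coord (w : 'rV[R]_M) i : R :=
  if x 0 i != 0 then x 0 i
  else if i \in E then - (Num.sqrt (maxmin base_weight gain_weight clash i) * xs 0 i)
  else if i \in early then
    - (Num.sqrt (maxmin (link_weight w) late_weight link_clash i) * w 0 i)
  else 0.

Lemma early_F i : i \in early -> i \in F.
Proof. by rewrite inE => /andP[]. Qed.

Lemma early_lost i : i \in early -> lost i.
Proof. by rewrite inE => /andP[_ /existsP[j /andP[_ /and3P[]]]]. Qed.

Lemma late_gained j : j \in late -> gained j.
Proof. by rewrite inE => /andP[]. Qed.

Lemma link_clash_early i j : link_clash i j -> i \in early.
Proof.
move=> /andP[cij jl]; rewrite inE; apply/andP; split; last first.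
  by apply/existsP; exists j; rewrite jl.
have /and3P[/andP[+ _] _ _] := cij; rewrite inE => /orP[iE|//].
by move: jl; rewrite inE => /andP[_ /forallP/(_ i)]; rewrite iE cij.
Qed.

Section Direction.
Variable w : 'rV[R]_M.
Hypothesis wF : orthant F w.

Let p (t : R) := xs + t *: w.

Let pE t i : i \in E -> p t 0 i = xs 0 i.
Proof.
move=> iE; rewrite !mxE; have [w0 _] := wF; rewrite w0 ?mulr0 ?addr0//.
by apply/negP => /(disjEF iE).
Qed.

Let pF t i : i \in F -> p t 0 i = t * w 0 i.
Proof.
move=> iF; rewrite !mxE; have [x0 _] := xsE; rewrite x0 ?add0r//.
by apply/negP => /disjEF; exact.
Qed.

Let p0 t i : i \notin E :|: F -> p t 0 i = 0.
Proof.
rewrite inE negb_or => /andP[iE iF]; rewrite !mxE.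
have [x0 _] := xsE; have [w0 _] := wF.
by rewrite x0// w0// mulr0 addr0.
Qed.

Let p_gt0 t i : 0 < t -> i \in E :|: F -> 0 < p t 0 i.
Proof.
move=> t0; rewrite inE => /orP[iE|iF]; first by rewrite pE//; exact: xsE.2.
by rewrite pF// mulr_gt0//; exact: wF.2.
Qed.

Let Xp t : 0 < t -> X (p t).
Proof.
by move=> t0; apply: EFX; split=> [i|i]; [exact: p0|exact: p_gt0].
Qed.

Let lostE t i : 0 < t -> vanishing (p t) x i = lost i.
Proof.
move=> t0; rewrite /vanishing /lost; have [iG|iG] := boolP (i \in _).
  by rewrite gt_eqF ?p_gt0.
by rewrite p0// eqxx.
Qed.

Let gainedE t i : 0 < t -> vanishing x (p t) i = gained i.
Proof.
move=> t0; rewrite /vanishing /gained andbC; have [iG|iG] := boolP (i \in _).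
  by rewrite gt_eqF ?p_gt0.
by rewrite p0// eqxx.
Qed.

Let clashE t : 0 < t -> conflict cmp (p t) x = clash.
Proof. by move=> t0; apply/funext => i; apply/funext => j; rewrite /conflict lostE// gainedE. Qed.

Let gainE t : 0 < t -> vweight x (p t) = gain_weight.
Proof. by move=> t0; apply/funext => j; rewrite /vweight gainedE. Qed.

Let loss t i := if lost i then p t 0 i ^+ 2 else 0.

Let lossE t : 0 < t -> vweight (p t) x = loss t.
Proof. by move=> t0; apply/funext => j; rewrite /vweight lostE. Qed.

Let prog_weights t : 0 < t -> weights (loss t) gain_weight clash.
Proof. by move=> t0; rewrite -lossE// -(gainE t0) -(clashE t0); exact: conflict_weights. Qed.

(** Bounds, uniformly in [0 < t <= 1], the cost of taking all values equal to 1. *)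
Definition loss_bound := \sum_i (xs 0 i ^+ 2 + w 0 i ^+ 2) + \sum_j gain_weight j.

Let cost_bound t a d : 0 < t -> t <= 1 -> optimal (loss t) gain_weight clash a d ->
  cost (loss t) gain_weight a d <= loss_bound.
Proof.
move=> t0 t1 /optimal_cost_le/le_trans; apply; rewrite /loss_bound lerD2r.
apply: ler_sum => i _; rewrite /loss; case: ifP => [/andP[iG _]|_]; last first.
  by rewrite addr_ge0 ?sqr_ge0.
move: iG; rewrite inE => /orP[iE|iF]; first by rewrite pE// lerDl sqr_ge0.
rewrite pF// exprMn ler_wpDl ?sqr_ge0// ler_piMl ?sqr_ge0//.
by rewrite exprn_ile1// ltW.
Qed.

(** The weights of the coordinates in [F] tend to 0 and the limiting weights are [base_weight],
    whence independence of [w]. *)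
Lemma cvg_base (a : R -> 'I_M -> R) (d : R -> 'I_M -> R) i :
  (forall t, 0 < t -> optimal (loss t) gain_weight clash (a t) (d t)) ->
  i \in E -> lost i ->
  a t i * p t 0 i @[t --> 0^'+] -->
    Num.sqrt (maxmin base_weight gain_weight clash i) * xs 0 i.
Proof.
move=> opt iE li.
have base_gt0 : 0 < base_weight i.
  by rewrite /base_weight li exprn_gt0//; exact: xsE.2.
have mm : maxmin (loss t) gain_weight clash i @[t --> 0^'+] -->
    maxmin base_weight gain_weight clash i.
  apply: cvg_maxmin => // k; first by rewrite /base_weight; case: ifP => // _; exact: sqr_ge0.
  rewrite /base_weight /loss; case: ifP => _; last exact: cvg_cst.
  rewrite expr2; under eq_fun do rewrite expr2.
  have pk : p t 0 k @[t --> 0^'+] --> xs 0 k.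
    under eq_fun do rewrite !mxE.
    have h : xs 0 k + t * w 0 k @[t --> (0 : R)^'+] --> xs 0 k + 0 * w 0 k.
      apply: cvgD; first exact: cvg_cst.
      apply: cvgM; last exact: cvg_cst.
      by apply: cvg_at_right_filter; exact: cvg_id.
    by rewrite mul0r addr0 in h.
  exact: cvgM.
have sq : Num.sqrt (maxmin (loss t) gain_weight clash i) @[t --> 0^'+] -->
    Num.sqrt (maxmin base_weight gain_weight clash i).
  exact: (cvg_comp _ _ mm (@sqrt_continuous R _)).
apply: (cvg_trans _ (cvgM sq (cvg_cst (xs 0 i)))); apply: near_eq_cvg; near=> t.
have t0 : 0 < t by near: t; exact: nbhs_right_gt.
have opt_t := opt t t0.
have Wi : 0 < loss t i by rewrite /loss li exprn_gt0// p_gt0//; case/andP: li.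
rewrite /= -(optimal_maxmin (prog_weights t0) opt_t Wi) sqrtr_sqr ger0_norm ?pE//.
by case: opt_t => -[].
Unshelve. all: by end_near. Qed.

(** Every [j] clashing with [i] also clashes with some [k] in [E], whose weight is fixed. This keeps
    [d j] away from 0, so [a i] stays bounded while the coordinate of the point tends to 0. *)
Lemma cvg_link_small (a : R -> 'I_M -> R) (d : R -> 'I_M -> R) i :
  (forall t, 0 < t -> optimal (loss t) gain_weight clash (a t) (d t)) ->
  i \in F -> i \notin early -> lost i ->
  a t i * p t 0 i @[t --> 0^'+] --> 0.
Proof.
move=> opt iF ie li.
(* The sum dominates the bounds coming from all [k] in [E] at once. *)
pose K := \sum_(k in E) loss_bound / xs 0 k ^+ 2.
have B0 : 0 <= loss_bound.
  rewrite addr_ge0// sumr_ge0// => j _; first by rewrite addr_ge0 ?sqr_ge0.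
  by rewrite /gain_weight; case: ifP => // _; exact: sqr_ge0.
have K0 : 0 <= K by rewrite sumr_ge0// => k _; rewrite divr_ge0 ?sqr_ge0.
have bnd : \forall t \near (0 : R)^'+, `|a t i * p t 0 i| <= (K * w 0 i) * t.
  near=> t.
  have t0 : 0 < t by near: t; exact: nbhs_right_gt.
  have t1 : t <= 1 by near: t; exact: nbhs_right_le.
  have opt_t := opt t t0; have we := prog_weights t0.
  have [[a0 d0 ad] mn] := opt_t.
  have w0 : 0 < w 0 i by exact: wF.2.
  rewrite pF// ger0_norm ?mulr_ge0 ?(ltW t0) ?(ltW w0)//.
  have -> : a t i * (t * w 0 i) = a t i * w 0 i * t by ring.
  rewrite ler_wpM2r ?(ltW t0)// ler_wpM2r ?(ltW w0)//.
  have Wi : 0 < loss t i by rewrite /loss li exprn_gt0// p_gt0//; case/andP: li.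
  apply: (optimal_min_le we opt_t Wi K0) => j cij.
  have gj : gained j by case/and3P: cij.
  have : j \notin late.
    apply/negP => jl; case/negP: ie; rewrite inE iF; apply/existsP; exists j; by rewrite jl.
  rewrite inE gj negb_forall => /existsP[k]; rewrite negb_imply negbK => /andP[kE ckj].
  have xk : 0 < xs 0 k by exact: xsE.2.
  have := feasible_lower we opt_t.1 (cost_bound t0 t1 opt_t) ckj.
  rewrite /loss; have -> : lost k by case/and3P: ckj.
  rewrite pE// => h.
  apply: (@le_trans _ _ (loss_bound / xs 0 k ^+ 2 * d t j)).
    by rewrite mulrAC ler_pdivlMr ?exprn_gt0// mul1r.
  rewrite ler_wpM2r// /K (bigD1 k)//= lerDl sumr_ge0// => l _.
  by rewrite divr_ge0 ?sqr_ge0.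
apply/cvgr0Pnorm_le => eps eps0.
have K1 : 0 < K * w 0 i + 1 by rewrite ltr_wpDl// mulr_ge0// ltW//; exact: wF.2.
near=> t; have t0 : 0 < t by near: t; exact: nbhs_right_gt.
apply: (@le_trans _ _ ((K * w 0 i) * t)); first by near: t; exact: bnd.
apply: (@le_trans _ _ ((K * w 0 i + 1) * t)).
  by rewrite ler_wpM2r ?(ltW t0)// lerDl.
rewrite mulrC -ler_pdivlMr//; near: t; apply: nbhs_right_le; exact: divr_gt0.
Unshelve. all: by end_near. Qed.

Lemma link_weights : weights (link_weight w) late_weight link_clash.
Proof.
split=> [i|j|i j cij].
- by rewrite /link_weight; case: ifP => // _; exact: sqr_ge0.
- by rewrite /late_weight; case: ifP => // _; exact: sqr_ge0.
have ie := link_clash_early cij; have /andP[cij' jl] := cij.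
rewrite /link_weight ie /late_weight jl exprn_gt0; last exact/wF.2/early_F.
by rewrite lt0r sqr_ge0 sqrf_eq0 andbT; case/andP: (late_gained jl).
Qed.

(* For small t the coordinates in [early] have to vanish so soon that they do not
   interact with the others: they solve the program of the link, scaled by t. *)
Lemma link_exact (a : R -> 'I_M -> R) (d : R -> 'I_M -> R) i a1 d1 :
  (forall t, 0 < t -> optimal (loss t) gain_weight clash (a t) (d t)) ->
  optimal (link_weight w) late_weight link_clash a1 d1 ->
  i \in early ->
  \forall t \near (0 : R)^'+, a t i * p t 0 i = a1 i * w 0 i.
Proof.
move=> opt opt1 ie.
have a1_gt0 k : k \in early -> 0 < a1 k.
  rewrite inE => /andP[_ /existsP[j /andP[jl ckj]]].
  have [[a0 d0 ad] _] := opt1.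
  rewrite lt0r a0 andbT; apply: contraTneq (ad k j _) => [->|]; last by rewrite /link_clash ckj.
  by rewrite mul0r ler10.
have smallt : \forall t \near (0 : R)^'+, forall kl : 'I_M * 'I_M,
    kl.1 \in early -> kl.2 \in E -> t * loss_bound <= a1 kl.1 * xs 0 kl.2 ^+ 2.
  apply: (@filter_forall R ('I_M * 'I_M)%type (fun kl t => kl.1 \in early ->
    kl.2 \in E -> t * loss_bound <= a1 kl.1 * xs 0 kl.2 ^+ 2) (0 : R)^'+) => -[k l] /=.
  have [ke|ke] := boolP (k \in early); last by apply: nearW.
  have [lE|lE] := boolP (l \in E); last by apply: nearW.
  have rhs : 0 < a1 k * xs 0 l ^+ 2 by rewrite mulr_gt0 ?a1_gt0// exprn_gt0//; exact: xsE.2.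
  have B1 : 0 < `|loss_bound| + 1 by rewrite ltr_wpDl.
  near=> t => _ _.
  apply: (@le_trans _ _ (t * (`|loss_bound| + 1))).
    by rewrite ler_wpM2l// ler_wpDr// ler_norm.
  rewrite -ler_pdivlMr//; near: t; apply: nbhs_right_le; exact: divr_gt0.
near=> t.
have t0 : 0 < t by near: t; exact: nbhs_right_gt.
have t1 : t <= 1 by near: t; exact: nbhs_right_le.
have sm : forall kl : 'I_M * 'I_M,
    kl.1 \in early -> kl.2 \in E -> t * loss_bound <= a1 kl.1 * xs 0 kl.2 ^+ 2.
  by near: t.
have we := prog_weights t0; have [W0 Y0 eWY] := we.
pose restr (S : {set 'I_M}) (V : 'I_M -> R) i := if i \in S then V i else 0.
pose e2 := [rel i j | [&& clash i j, i \notin early & j \notin late]].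
have we2 : weights (restr (~: early) (loss t)) (restr (~: late) gain_weight) e2.
  split=> [k|k|k l /and3P[/eWY[Wk Yl] ke ll]]; rewrite /restr.
  - by case: ifP.
  - by case: ifP.
  - by rewrite !finset.in_setC ke ll.
have [a2 [d2 opt2]] := optimal_exists we2.
have optt : optimal (loss t) gain_weight clash
    (fun i => if i \in early then a1 i / t else a2 i)
    (fun j => if j \in late then t * d1 j else d2 j).
  apply: optimal_decouple => //.
  - by move=> k l ckl ll; apply: (@link_clash_early k l); rewrite /link_clash ckl.
  - have := optimal_scale t0 opt1.
    have -> : (fun k => t ^+ 2 * link_weight w k) = restr early (loss t).
      apply/funext => k; rewrite /restr /link_weight /loss; case: ifP => ke; last by rewrite mulr0.
      by rewrite (early_lost ke) pF ?exprMn//; exact: early_F.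
    have -> // : late_weight = restr late gain_weight.
    apply/funext => l; rewrite /late_weight /restr /gain_weight; case: ifP => // ll.
    by rewrite (late_gained ll).
  (* Cross constraints: [l] clashes with some [h] in [E], so [d2 l] is at least
     [xs 0 h ^+ 2 / loss_bound], and for small [t] the factor [a1 k / t] is large enough. *)
  move=> k l ckl ke ll.
  have gl : gained l by case/and3P: ckl.
  move: (ll); rewrite inE gl negb_forall => /existsP[h].
  rewrite negb_imply negbK => /andP[hE chl].
  have he : h \notin early by apply/negP => /early_F/(disjEF hE).
  have c2 : cost (restr (~: early) (loss t)) (restr (~: late) gain_weight) a2 d2 <= loss_bound.
    apply: le_trans (cost_bound t0 t1 (opt t t0)).
    apply: (@le_trans _ _ (cost (restr (~: early) (loss t)) (restr (~: late) gain_weight)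
      (a t) (d t))).
      have [[a0 d0 ad] _] := opt t t0.
      by apply: opt2.2; split=> // u v /and3P[/ad].
    have [[a0 d0 _] _] := opt t t0.
    apply: lerD; apply: ler_sum => u _; rewrite ler_wpM2r// /restr; case: ifP => // _.
  have := feasible_lower we2 opt2.1 c2 (i := h) (j := l).
  rewrite /e2/= chl he ll /restr inE he /loss => /(_ isT).
  have -> : lost h by case/and3P: chl.
  rewrite pE// => hd; rewrite mulrAC ler_pdivlMr// mul1r.
  have := sm (k, h) ke hE; rewrite /= => h1.
  have xh : 0 < xs 0 h ^+ 2 by rewrite exprn_gt0//; exact: xsE.2.
  have B0 : 0 < loss_bound * d2 l by exact: lt_le_trans hd.
  have d2l : 0 <= d2 l by case: opt2 => -[].
  have d2p : 0 < d2 l.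
    by rewrite lt0r d2l andbT; apply: contraTneq B0 => ->; rewrite mulr0 ltxx.
  have Bp : 0 < loss_bound by move: B0; rewrite pmulr_lgt0.
  rewrite -(ler_pM2r Bp); apply: (le_trans h1).
  have -> : a1 k * d2 l * loss_bound = a1 k * (loss_bound * d2 l) by ring.
  by rewrite ler_wpM2l// ltW// a1_gt0.
have Wi : 0 < loss t i.
  by rewrite /loss early_lost// exprn_gt0// p_gt0// inE early_F ?orbT.
rewrite (optimal_unique we (opt t t0) optt Wi) ie pF ?early_F//.
by field; rewrite gt_eqF.
Unshelve. all: by end_near. Qed.

Lemma Psi_stratumE :
  Psi_stratum X E F x w xs = \row_i if i \in E :|: F then Psi_coord w i else 0.
Proof.
have [a ha] : exists a : R -> 'I_M -> R, forall t, 0 < t ->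
    exists d, optimal (loss t) gain_weight clash (a t) d.
  have : forall t : R, exists a, 0 < t -> exists d, optimal (loss t) gain_weight clash a d.
    move=> t; have [t0|t0] := ltP 0 t; last by exists (fun=> 0).
    by have [a [d]] := optimal_exists (prog_weights t0); exists a => _; exists d.
  by move=> /choice[a]; exists a.
have [d opt] : exists d : R -> 'I_M -> R, forall t, 0 < t ->
    optimal (loss t) gain_weight clash (a t) (d t).
  have : forall t : R, exists d, 0 < t -> optimal (loss t) gain_weight clash (a t) d.
    move=> t; have [t0|t0] := ltP 0 t; last by exists (fun=> 0).
    by have [d] := ha t t0; exists d.
  by move=> /choice[d]; exists d.
(* The coordinates outside [E :|: F]: they do not depend on [t], and the projection removes them. *)
pose free i := if gained i && [exists j, clash j i] then 0 else x 0 i.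
have PhiE t : 0 < t -> Phi X x (p t) = \row_i
    if i \in E :|: F then (if x 0 i != 0 then x 0 i else - (a t i * p t 0 i)) else free i.
  move=> t0; have o : opt_schedule cmp (p t) x (a t) (d t).
    by rewrite /opt_schedule lossE// gainE// clashE//; exact: opt.
  rewrite /Phi (log_mapE cmp_sym (Xp t0) Xx o); apply/rowP => i.
  rewrite [LHS]mxE [RHS]mxE [initial_velocity _ _ _ _ _ _]mxE lostE// gainedE// clashE//.
  rewrite /lost /gained /free /gained; have [iG|iG] /= := boolP (i \in E :|: F).
    by case: eqVneq => [x0|x0] /=; ring.
  by rewrite p0//; case: ifP => _; rewrite ?addr0 ?subr0.
pose L : 'rV[R]_M := \row_i if i \in E :|: F then Psi_coord w i else free i.
have PsiE : Psi X x w xs = L.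
  rewrite /Psi; apply: cvg_lim; first exact: norm_hausdorff.
  apply: (@cvg_trans _ ((\row_i
    if i \in E :|: F then (if x 0 i != 0 then x 0 i else - (a t i * p t 0 i)) else free i)
      @[t --> (0 : R)^'+])).
    apply: near_eq_cvg; near=> t.
    have t0 : 0 < t by near: t; exact: nbhs_right_gt.
    by rewrite /= -PhiE.
  apply: cvg_row => i; rewrite mxE; under eq_fun do rewrite mxE.
  case: ifPn => iG; last exact: cvg_cst.
  rewrite /Psi_coord; case: ifPn => xi; first exact: cvg_cst.
  rewrite negbK in xi; have li : lost i by rewrite /lost iG.
  case: ifPn => iE; first by apply: cvgN; exact: cvg_base opt iE li.
  have iF : i \in F by move: iG; rewrite inE (negPf iE).
  case: ifPn => ie; last first.
    have h := cvgN (cvg_link_small opt iF ie li); rewrite oppr0 in h; exact: h.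
  have [a1 [d1 opt1]] := optimal_exists link_weights.
  apply: cvgN; apply: cvg_near_cst.
  have Wi : 0 < link_weight w i by rewrite /link_weight ie exprn_gt0//; exact: wF.2.
  rewrite -(optimal_maxmin link_weights opt1 Wi) sqrtr_sqr ger0_norm; last by case: opt1 => -[].
  exact: link_exact opt opt1 ie.
rewrite /Psi_stratum PsiE; apply/rowP => i; rewrite /proj_span summxE mxE.
under eq_bigr do rewrite !mxE eqxx/=.
case: ifPn => iG.
  rewrite (bigD1 i)//= eqxx mulr1 iG big1 ?addr0// => j /andP[_ ji].
  by rewrite eq_sym (negPf ji) mulr0.
rewrite big1// => j jG; case: eqVneq => [ij|_]; last by rewrite mulr0.
by rewrite ij jG in iG.
Unshelve. all: by end_near. Qed.

End Direction.
End PsiLimit.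
(** * One-sided derivatives along great circles *)

Section RightDerivative.
Context {R : realType}.
Implicit Types (f g : R -> R) (l : R).

Definition right_derive f l := s^-1 * (f s - f 0) @[s --> 0^'+] --> l.

Lemma right_derive_near f g l : (\forall s \near 0^'+, f s = g s) -> f 0 = g 0 ->
  right_derive f l -> right_derive g l.
Proof.
move=> fg fg0 fl; apply: (cvg_trans _ fl); apply: near_eq_cvg.
by apply: filterS fg => s ->; rewrite fg0.
Qed.

Lemma right_derive_cvg f l : right_derive f l -> f s @[s --> 0^'+] --> f 0.
Proof.
move=> fl.
have id0 : s @[s --> (0 : R)^'+] --> (0 : R) by apply: cvg_at_right_filter; exact: cvg_id.
have h : f 0 + s * (s^-1 * (f s - f 0)) @[s --> 0^'+] --> f 0 + 0 * l.
  by apply: cvgD; [exact: cvg_cst|exact: cvgM].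
rewrite mul0r addr0 in h; apply: (cvg_trans _ h); apply: near_eq_cvg; near=> s.
have s0 : s != 0 by rewrite gt_eqF//; near: s; exact: nbhs_right_gt.
by field.
Unshelve. all: by end_near. Qed.

Lemma right_derive_cst (c : R) : right_derive (fun=> c) 0.
Proof. by rewrite /right_derive subrr; under eq_fun do rewrite mulr0; exact: cvg_cst. Qed.

Lemma right_deriveD f g l l' : right_derive f l -> right_derive g l' ->
  right_derive (fun s => f s + g s) (l + l').
Proof.
move=> fl gl.
have h : s^-1 * (f s - f 0) + s^-1 * (g s - g 0) @[s --> 0^'+] --> l + l' by exact: cvgD.
by apply: (cvg_trans _ h); apply: near_eq_cvg; apply: nearW => s /=; ring.
Qed.

Lemma right_derive_sum {I : Type} (r : seq I) (P : pred I) (f : I -> R -> R) (l : I -> R) :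
  (forall i, P i -> right_derive (f i) (l i)) ->
  right_derive (fun s => \sum_(i <- r | P i) f i s) (\sum_(i <- r | P i) l i).
Proof.
move=> fl; elim: r => [|i r IH].
  by rewrite big_nil; under eq_fun do rewrite big_nil; exact: right_derive_cst.
rewrite big_cons; under eq_fun do rewrite big_cons.
by case: ifPn => // Pi; apply: right_deriveD => //; exact: fl.
Qed.

Lemma right_deriveM f g l l' : right_derive f l -> right_derive g l' ->
  right_derive (fun s => f s * g s) (l * g 0 + f 0 * l').
Proof.
move=> fl gl; have gc := right_derive_cvg gl.
have h : s^-1 * (f s - f 0) * g s + f 0 * (s^-1 * (g s - g 0)) @[s --> 0^'+] -->
    l * g 0 + f 0 * l'.
  by apply: cvgD; [exact: cvgM|apply: cvgM => //; exact: cvg_cst].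
by apply: (cvg_trans _ h); apply: near_eq_cvg; apply: nearW => s /=; ring.
Qed.

Lemma right_deriveN f l : right_derive f l -> right_derive (fun s => - f s) (- l).
Proof.
move=> fl; have h : - (s^-1 * (f s - f 0)) @[s --> 0^'+] --> - l by exact: cvgN.
by apply: (cvg_trans _ h); apply: near_eq_cvg; apply: nearW => s /=; ring.
Qed.

Lemma right_deriveV f l : f 0 != 0 -> right_derive f l ->
  right_derive (fun s => (f s)^-1) (- (l / (f 0 * f 0))).
Proof.
move=> f0 fl; have fc := right_derive_cvg fl.
have ffc : f s * f 0 @[s --> 0^'+] --> f 0 * f 0 by apply: cvgM => //; exact: cvg_cst.
have ff0 : f 0 * f 0 != 0 by rewrite mulf_neq0.
have h : - (s^-1 * (f s - f 0) * (f s * f 0)^-1) @[s --> 0^'+] --> - (l / (f 0 * f 0)).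
  by apply: cvgN; apply: cvgM => //; exact: cvgV.
apply: (cvg_trans _ h); apply: near_eq_cvg.
have fne : \forall s \near 0^'+, f s != 0.
  have nb : nbhs (f 0) [set y : R | y != 0] by apply: open_nbhs_nbhs; split=> //; exact: open_neq.
  exact: fc nb.
near=> s.
have s0 : s != 0 by rewrite gt_eqF//; near: s; exact: nbhs_right_gt.
have fs : f s != 0 by near: s.
by field; rewrite s0 f0 fs.
Unshelve. all: by end_near. Qed.

Lemma right_derive_sqrt f l : 0 < f 0 -> right_derive f l ->
  right_derive (fun s => Num.sqrt (f s)) (l / (Num.sqrt (f 0) + Num.sqrt (f 0))).
Proof.
move=> f0 fl; have fc := right_derive_cvg fl.
have sc : Num.sqrt (f s) + Num.sqrt (f 0) @[s --> 0^'+] --> Num.sqrt (f 0) + Num.sqrt (f 0).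
  apply: cvgD; last exact: cvg_cst.
  exact: (cvg_comp _ _ fc (@sqrt_continuous R _)).
have sq0 : 0 < Num.sqrt (f 0) by rewrite sqrtr_gt0.
have ss : Num.sqrt (f 0) + Num.sqrt (f 0) != 0 by rewrite gt_eqF// addr_gt0.
have h : s^-1 * (f s - f 0) * (Num.sqrt (f s) + Num.sqrt (f 0))^-1 @[s --> 0^'+] -->
    l / (Num.sqrt (f 0) + Num.sqrt (f 0)).
  by apply: cvgM => //; exact: cvgV.
apply: (cvg_trans _ h); apply: near_eq_cvg.
have fpos : \forall s \near 0^'+, 0 < f s.
  have nb : nbhs (f 0) [set y : R | 0 < y] by apply: open_nbhs_nbhs; split=> //; exact: open_gt.
  exact: fc nb.
near=> s.
have fs : 0 < f s by near: s.
have sp : Num.sqrt (f s) + Num.sqrt (f 0) != 0 by rewrite gt_eqF// ltr_wpDl// sqrtr_ge0.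
rewrite /= -mulrA; congr (_ * _); apply: (mulIf sp); rewrite divfK//.
rewrite -{1}(sqr_sqrtr (ltW fs)) -{1}(sqr_sqrtr (ltW f0)); ring.
Unshelve. all: by end_near. Qed.

(** At a tie the one-sided derivative is the maximum of the two; otherwise the larger function wins
    near 0. *)
Lemma right_derive_max f g l l' : right_derive f l -> right_derive g l' ->
  exists k, right_derive (fun s => Num.max (f s) (g s)) k.
Proof.
wlog : f g l l' / g 0 <= f 0 => [wl fl gl|].
  have [gf|/ltW fg] := leP (g 0) (f 0); first exact: wl gf fl gl.
  have [k hk] := wl _ _ _ _ fg gl fl.
  by exists k; under eq_fun do rewrite maxC.
rewrite le_eqVlt => /predU1P[e|gf] fl gl.
  exists (Num.max l l'); apply: (cvg_trans _ (cvg_maxr fl gl)); apply: near_eq_cvg.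
  near=> s; have s0 : 0 < s by near: s; exact: nbhs_right_gt.
  by rewrite e maxxx -maxr_pMr ?invr_ge0 ?ltW// addr_maxl.
have fc := right_derive_cvg fl; have gc := right_derive_cvg gl.
exists l; apply: right_derive_near fl; last by rewrite (max_idPl (ltW gf)).
have : \forall s \near 0^'+, 0 < f s - g s.
  have nb : nbhs (f 0 - g 0) [set y : R | 0 < y].
    by apply: open_nbhs_nbhs; split; [exact: open_gt|rewrite /= subr_gt0].
  exact: (cvgB fc gc) nb.
by apply: filterS => s; rewrite subr_gt0 => /ltW/max_idPl->.
Unshelve. all: by end_near. Qed.

Lemma right_derive_min f g l l' : right_derive f l -> right_derive g l' ->
  exists k, right_derive (fun s => Num.min (f s) (g s)) k.
Proof.
move=> fl gl; have [k hk] := right_derive_max (right_deriveN fl) (right_deriveN gl).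
exists (- k); under eq_fun do rewrite -[Num.min _ _]opprK oppr_min.
exact: right_deriveN hk.
Qed.

Lemma right_derive_bigmax {I : Type} (r : seq I) (P : pred I) (f : I -> R -> R) (c : R) :
  (forall i, P i -> exists l, right_derive (f i) l) ->
  exists l, right_derive (fun s => \big[Num.max/c]_(i <- r | P i) f i s) l.
Proof.
move=> fl; elim: r => [|i r [l IH]].
  by exists 0; under eq_fun do rewrite big_nil; exact: right_derive_cst.
have [Pi|Pi] := boolP (P i); last first.
  by exists l; under eq_fun do rewrite big_cons (negPf Pi).
have [k fik] := fl i Pi; have [m hm] := right_derive_max fik IH.
by exists m; under eq_fun do rewrite big_cons Pi.
Qed.

Lemma right_derive_bigmin {I : Type} (r : seq I) (P : pred I) (f : I -> R -> R) (g : R -> R) :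
  (exists l, right_derive g l) ->
  (forall i, P i -> exists l, right_derive (f i) l) ->
  exists l, right_derive (fun s => \big[Num.min/g s]_(i <- r | P i) f i s) l.
Proof.
move=> [l0 gl] fl; elim: r => [|i r [l IH]].
  by exists l0; under eq_fun do rewrite big_nil.
have [Pi|Pi] := boolP (P i); last first.
  by exists l; under eq_fun do rewrite big_cons (negPf Pi).
have [k fik] := fl i Pi; have [m hm] := right_derive_min fik IH.
by exists m; under eq_fun do rewrite big_cons Pi.
Qed.

Lemma right_derive_maxmin {n : nat} (W : R -> 'I_n -> R) (W' Y : 'I_n -> R) (e : rel 'I_n) i :
  (forall k, 0 <= W 0 k) -> 0 < W 0 i ->
  (forall k, right_derive (W^~ k) (W' k)) ->
  exists l, right_derive (fun s => maxmin (W s) Y e i) l.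
Proof.
move=> W0 Wi Wd.
have ratio (L U : {set 'I_n} * {set 'I_n}) : i \in L.1 -> i \in U.1 ->
    exists l, right_derive (fun s => set_ratio (W s) Y L U) l.
  move=> iL iU; eexists; apply: right_deriveM; first exact: right_derive_cst.
  apply: right_deriveV; last by apply: right_derive_sum => k _; exact: Wd.
  by rewrite gt_eqF// (bigD1 i) ?inE ?iL//= ltr_wpDr// sumr_ge0.
apply: right_derive_bigmax => L /andP[iL _]; apply: right_derive_bigmin.
  by apply: ratio => //; rewrite finset.in_setT.
by move=> U /andP[iU _]; exact: ratio.
Qed.

Lemma right_derive_le0 f l : (\forall s \near 0^'+, f s <= f 0) -> right_derive f l -> l <= 0.
Proof.
move=> ff fl; apply: (ler_cvg_to fl (cvg_cst (0 : R))); near=> s.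
have s0 : 0 < s by near: s; exact: nbhs_right_gt.
by rewrite pmulr_rle0 ?invr_gt0// subr_le0; near: s.
Unshelve. all: by end_near. Qed.

Lemma derive_right f l : is_derive (0 : R) (1 : R) f l -> right_derive f l.
Proof.
move=> [df <-]; have h := cvg_dnbhs_at_right df.
by apply: (cvg_trans _ h); apply: near_eq_cvg; apply: nearW => s /=;
  rewrite addr0 [s *: _]mulr1.
Qed.

End RightDerivative.

Lemma great_circle_derive {R : realType} {M : nat} (w v : 'rV[R]_M) i :
  right_derive (fun s => great_circle w v s 0 i) (v 0 i).
Proof.
rewrite /great_circle; set n := enorm v.
(* For [n = 0] both sides are 0, because then [v = 0]. *)
have vE : n * (n^-1 * v 0 i) = v 0 i.
  have [n0|n0] := eqVneq n 0; last by rewrite mulrA divff// mul1r.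
  rewrite n0 mul0r; apply/esym/eqP; rewrite -sqrf_eq0 eq_le sqr_ge0 andbT.
  by apply: le_trans (coord_le_enorm v i) _; rewrite -/n n0 expr0n.
have -> : (fun s => (cos (n * s) *: w + sin (n * s) *: (n^-1 *: v)) 0 i) =
    (fun s => cos (n * s) * w 0 i + sin (n * s) * (n^-1 * v 0 i)).
  by apply/funext => s; rewrite !mxE.
have cosn : right_derive (fun s => cos (n * s)) 0.
  apply: derive_right.
  have dn : is_derive (0 : R) (1 : R) (fun s : R => n * s) n.
    by apply: is_derive_eq; rewrite [_ *: _]mulr1.
  have := is_derive1_comp (is_derive_cos (n * 0)) dn.
  by rewrite mulr0 sin0 oppr0 mul0r.
have sinn : right_derive (fun s => sin (n * s)) n.
  apply: derive_right.
  have dn : is_derive (0 : R) (1 : R) (fun s : R => n * s) n.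
    by apply: is_derive_eq; rewrite [_ *: _]mulr1.
  have := is_derive1_comp (is_derive_sin (n * 0)) dn.
  by rewrite mulr0 cos0 mul1r.
have := right_deriveD (right_deriveM cosn (right_derive_cst (w 0 i)))
  (right_deriveM sinn (right_derive_cst (n^-1 * v 0 i))).
by rewrite !mulr0 !addr0 mul0r add0r vE.
Qed.

Lemma great_circle0 {R : realType} {M : nat} (w v : 'rV[R]_M) : great_circle w v 0 = w.
Proof. by rewrite /great_circle mulr0 cos0 sin0 scale0r addr0 scale1r. Qed.

(** * Derivative along the link and orthogonality *)

Section LinkDerivative.
Context {R : realType} {M : nat} (cmp : rel 'I_M).
Hypothesis cmp_sym : symmetric cmp.
Local Notation X := (@clique_space R M cmp).
Variables (E F : {set 'I_M}) (x xs w v : 'rV[R]_M).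
Hypotheses (EF0 : [disjoint E & F]%B) (EFX : orthant (E :|: F) `<=` X)
  (Xx : X x) (xsE : orthant E xs) (wF : orthant F w) (vF : Defs.coord_span F v).

Let alpha := great_circle w v.
Let early := @early R M cmp E F x.
Let root (u : 'rV[R]_M) i : R := Num.sqrt (maxmin (link_weight cmp E F x u)
  (late_weight cmp E F x) (link_clash cmp E F x) i).

Let earlyF i : i \in early -> i \in F.
Proof. exact: early_F. Qed.

Lemma near_great_circle : \forall s \near (0 : R)^'+, orthant F (alpha s).
Proof.
have : \forall s \near (0 : R)^'+, forall i, i \in F -> 0 < alpha s 0 i.
  apply: (@filter_forall R 'I_M (fun i s => i \in F -> 0 < alpha s 0 i) (0 : R)^'+) => i.
  have [iF|iF] := boolP (i \in F); last by apply: nearW.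
  have nb : nbhs (alpha 0 0 i) [set y : R | 0 < y].
    apply: open_nbhs_nbhs; split; first exact: open_gt.
    by rewrite /alpha great_circle0/=; exact: wF.2.
  have h : \forall s \near (0 : R)^'+, 0 < alpha s 0 i.
    exact: (right_derive_cvg (@great_circle_derive R M w v i) nb).
  by apply: filterS h => s as0 _.
apply: filterS => s pos; split=> // i iF; rewrite !mxE.
by rewrite (wF.1 i iF) (vF iF) !mulr0 addr0.
Qed.

Let optimal_root u a d i : orthant F u ->
  optimal (link_weight cmp E F x u) (late_weight cmp E F x) (link_clash cmp E F x) a d ->
  i \in early -> a i = root u i.
Proof.
move=> uF opt ie; have we := link_weights cmp E x uF.
have Wi : 0 < link_weight cmp E F x u i.
  by rewrite /link_weight ie exprn_gt0//; apply: uF.2; exact: earlyF.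
rewrite /root -(optimal_maxmin we opt Wi) sqrtr_sqr ger0_norm//.
by case: opt => -[].
Qed.

(** An early coordinate has a conflict, so its optimal value is positive and the square root is
    differentiable there. *)
Let root_gt0 i : i \in early -> 0 < maxmin (link_weight cmp E F x w)
  (late_weight cmp E F x) (link_clash cmp E F x) i.
Proof.
move=> ie; have we := link_weights cmp E x wF.
have [a [d opt]] := optimal_exists we.
have Wi : 0 < link_weight cmp E F x w i.
  by rewrite /link_weight ie exprn_gt0//; apply: wF.2; exact: earlyF.
rewrite -(optimal_maxmin we opt Wi) exprn_gt0//.
have [[a0 _ ad] _] := opt; rewrite lt0r a0 andbT.
move: ie; rewrite /early inE => /andP[_ /existsP[j /andP[jl cij]]].
apply: contraTneq (ad i j _) => [->|]; first by rewrite mul0r ler10.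
by rewrite /link_clash cij.
Qed.

Lemma root_derivable i : i \in early -> exists l, right_derive (fun s => root (alpha s) i) l.
Proof.
move=> ie.
have [||k|l hl] := @right_derive_maxmin R M (fun s => link_weight cmp E F x (alpha s))
  (fun k => if k \in early then v 0 k * alpha 0 0 k + alpha 0 0 k * v 0 k else 0)
  (late_weight cmp E F x) (link_clash cmp E F x) i.
- by move=> k; rewrite /link_weight; case: ifP => // _; exact: sqr_ge0.
- rewrite /link_weight ie exprn_gt0// /alpha great_circle0.
  by apply: wF.2; exact: earlyF.
- rewrite /link_weight -/early; case: ifP => _; last exact: right_derive_cst.
  by under eq_fun do rewrite expr2; apply: right_deriveM; exact: great_circle_derive.
eexists; apply: right_derive_sqrt hl.
by rewrite /alpha great_circle0; exact: root_gt0.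
Qed.

Let link_action (u : 'rV[R]_M) : R := \sum_(i in early) u 0 i * u 0 i * root u i.

(* Half the minimal cost is spent on the vanishing coordinates, and the optimal
   schedule for u' is feasible for u. *)
Let envelope u u' : orthant F u -> orthant F u' ->
  2 * link_action u <= 2 * link_action u' +
    \sum_(i in early) (u 0 i * u 0 i - u' 0 i * u' 0 i) * root u' i.
Proof.
have sumE z b : \sum_i link_weight cmp E F x z i * b i =
    \sum_(i in early) z 0 i * z 0 i * b i.
  rewrite [RHS]big_mkcond/=; apply: eq_bigr => i _; rewrite /link_weight.
  by rewrite -/early; case: ifP => _; rewrite ?mul0r// expr2.
have costE z a d : orthant F z ->
    optimal (link_weight cmp E F x z) (late_weight cmp E F x) (link_clash cmp E F x) a d ->
    cost (link_weight cmp E F x z) (late_weight cmp E F x) a d = 2 * link_action z.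
  move=> zF opt; rewrite /cost -(optimal_balance (link_weights cmp E x zF) opt) sumE.
  rewrite mulr2n mulrDl mul1r /link_action.
  by congr (_ + _); apply: eq_bigr => i ie; rewrite (optimal_root zF opt ie).
move=> uF u'F.
have [a [d opt]] := optimal_exists (link_weights cmp E x uF).
have [a' [d' opt']] := optimal_exists (link_weights cmp E x u'F).
rewrite -(costE _ _ _ uF opt) -(costE _ _ _ u'F opt').
apply: (le_trans (opt.2 _ _ opt'.1)).
rewrite /cost addrAC !sumE -big_split/=.
rewrite lerD2r; apply: ler_sum => i ie; rewrite -(optimal_root u'F opt' ie).
by rewrite le_eqVlt; apply/orP; left; apply/eqP; ring.
Qed.

(** [envelope] for the pairs [(alpha s, w)] and [(w, alpha s)] gives two functions with a maximum at
    0, so the same one-sided derivative [2 * N' - K] is bounded by 0 from both sides. In the second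
    one the derivative of [root (alpha s)] drops out because its factor vanishes at [s = 0]. *)
Lemma link_orthogonal (b' : 'I_M -> R) :
  (forall i, i \in early -> right_derive (fun s => root (alpha s) i) (b' i)) ->
  \sum_(i in early) w 0 i * (b' i * w 0 i + root w i * v 0 i) = 0.
Proof.
move=> b'E.
have alpha0 : alpha 0 = w by exact: great_circle0.
have da i : right_derive (fun s => alpha s 0 i) (v 0 i) by exact: great_circle_derive.
have dsq i : right_derive (fun s => alpha s 0 i * alpha s 0 i) (v 0 i * w 0 i + w 0 i * v 0 i).
  by have := right_deriveM (da i) (da i); rewrite alpha0.
pose N' := \sum_(i in early)
  ((v 0 i * w 0 i + w 0 i * v 0 i) * root w i + w 0 i * w 0 i * b' i).
have dN : right_derive (fun s => link_action (alpha s)) N'.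
  apply: right_derive_sum => i ie.
  by have := right_deriveM (dsq i) (b'E i ie); rewrite alpha0.
have d2N : right_derive (fun s => 2 * link_action (alpha s)) (2 * N').
  by have := right_deriveM (right_derive_cst 2) dN; rewrite mul0r add0r.
pose K := \sum_(i in early) (v 0 i * w 0 i + w 0 i * v 0 i) * root w i.
have N'_le : 2 * N' - K <= 0.
  have d1 : right_derive (fun s => 2 * link_action (alpha s) -
      \sum_(i in early) (alpha s 0 i * alpha s 0 i - w 0 i * w 0 i) * root w i) (2 * N' - K).
    apply: right_deriveD d2N _; apply: right_deriveN; apply: right_derive_sum => i ie.
    have := right_deriveM (right_deriveD (dsq i) (right_derive_cst (- (w 0 i * w 0 i))))
      (right_derive_cst (root w i)).
    by rewrite mulr0 !addr0.
  apply: right_derive_le0 d1; apply: filterS near_great_circle => s asF.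
  rewrite alpha0 [X in _ <= _ - X]big1 => [|i _]; last by rewrite subrr mul0r.
  by rewrite subr0 lerBlDr; exact: envelope.
have N'_ge : - (2 * N' - K) <= 0.
  have d1 : right_derive (fun s => - (2 * link_action (alpha s) +
      \sum_(i in early) (w 0 i * w 0 i - alpha s 0 i * alpha s 0 i) * root (alpha s) i))
      (- (2 * N' - K)).
    apply: right_deriveN; apply: right_deriveD d2N _.
    rewrite /K -sumrN; apply: right_derive_sum => i ie.
    have := right_deriveM (right_deriveD (right_derive_cst (w 0 i * w 0 i))
      (right_deriveN (dsq i))) (b'E i ie).
    by rewrite alpha0 subrr mul0r addr0 add0r mulNr.
  apply: right_derive_le0 d1; apply: filterS near_great_circle => s asF.
  rewrite alpha0 [X in _ <= - (_ + X)]big1 => [|i _]; last by rewrite subrr mul0r.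
  by rewrite addr0 lerN2; exact: envelope.
have NK : 2 * N' = K by apply/eqP; rewrite -subr_eq0 eq_le N'_le -oppr_le0.
have -> : \sum_(i in early) w 0 i * (b' i * w 0 i + root w i * v 0 i) = N' - K / 2.
  rewrite /N' /K mulr_suml -sumrB; apply: eq_bigr => i _.
  by field.
by rewrite -NK; field.
Qed.

(** Only the early coordinates of the closed form vary along the arc, and their derivatives are
    minus the terms of [link_orthogonal]. *)
Lemma arc_derive_Psi : exists2 D : 'rV[R]_M,
  arc_quotient (fun w' => Psi_stratum X E F x w' xs) w v s @[s --> 0^'+] --> D & dot w D = 0.
Proof.
have [b' b'E] : exists b' : 'I_M -> R, forall i, i \in early ->
    right_derive (fun s => root (alpha s) i) (b' i).
  have : forall i, exists l, i \in early -> right_derive (fun s => root (alpha s) i) l.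
    move=> i; have [ie|ie] := boolP (i \in early); last by exists 0.
    by have [l] := root_derivable ie; exists l.
  by move=> /choice[b']; exists b'.
pose D : 'rV[R]_M := \row_i if i \in early then - (b' i * w 0 i + root w i * v 0 i) else 0.
exists D; last first.
  transitivity (- \sum_(i in early) w 0 i * (b' i * w 0 i + root w i * v 0 i)).
    rewrite /dot -sumrN [RHS]big_mkcond/=.
    by apply: eq_bigr => i _; rewrite mxE; case: ifP => _; rewrite ?mulr0// mulrN.
  by rewrite (link_orthogonal b'E) oppr0.
have alpha0 : alpha 0 = w by exact: great_circle0.
pose f s : 'rV[R]_M := \row_i if i \in E :|: F then Psi_coord cmp E F x xs (alpha s) i else 0.
apply: (@cvg_trans _ (s^-1 *: (f s - f 0) @[s --> (0 : R)^'+])).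
  apply: near_eq_cvg; apply: filterS near_great_circle => s asF.
  rewrite /arc_quotient (Psi_stratumE cmp_sym EF0 EFX Xx xsE asF).
  by rewrite (Psi_stratumE cmp_sym EF0 EFX Xx xsE wF) /f alpha0.
apply: cvg_row => i.
have -> : (fun s => (s^-1 *: (f s - f 0)) 0 i) = (fun s => s^-1 * (f s 0 i - f 0 0 i)).
  by apply/funext => s; rewrite !mxE.
suff : right_derive (fun s => f s 0 i) (D 0 i) by [].
rewrite mxE.
have -> : (fun s => f s 0 i) = (fun s => if i \in E :|: F then
    Psi_coord cmp E F x xs (alpha s) i else 0) by apply/funext => s; rewrite mxE.
have [ie|ie] := boolP (i \in early).
  have iF := earlyF ie; have /andP[iG /eqP xi] := early_lost ie.
  rewrite iG; have iE : i \notin E.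
    by apply/negP => iE; have /pred0P/(_ i) := EF0; rewrite /= iE iF.
  rewrite /Psi_coord xi eqxx/= (negPf iE) -/early ie.
  apply: right_deriveN; have := right_deriveM (b'E i ie) (@great_circle_derive R M w v i).
  by rewrite -/alpha alpha0.
have [iG|iG] := boolP (i \in E :|: F); last exact: right_derive_cst.
rewrite /Psi_coord; have [xi|xi] := boolP (x 0 i != 0); first exact: right_derive_cst.
have [iE|iE] := boolP (i \in E); first exact: right_derive_cst.
by rewrite -/early (negPf ie); exact: right_derive_cst.
Qed.

End LinkDerivative.

(** * Orthant spaces as clique spaces *)

Section OrthantSpace.
Context {R : realType} {M : nat}.
Implicit Types (A G : {set 'I_M}) (y : 'rV[R]_M).

Lemma orthant_closure A G : G \subset A ->
  @orthant R M G `<=` closure (@orthant R M A).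
Proof.
move=> /fintype.subsetP GA y [y0 yG] B By.
pose g (s : R) : 'rV[R]_M := \row_i (y 0 i + s * (i \in A)%:R).
have gy : g s @[s --> (0 : R)^'+] --> y.
  apply: cvg_row => i; under eq_fun do rewrite mxE.
  have h : y 0 i + s * (i \in A)%:R @[s --> (0 : R)^'+] --> y 0 i + 0 * (i \in A)%:R.
    apply: cvgD; first exact: cvg_cst.
    by apply: cvgM; [apply: cvg_at_right_filter; exact: cvg_id|exact: cvg_cst].
  by rewrite mul0r addr0 in h.
have gB : \forall s \near (0 : R)^'+, B (g s) by exact: gy By.
near (0 : R)^'+ => s; exists (g s); split; last by near: s.
have s0 : 0 < s by near: s; exact: nbhs_right_gt.
split=> i iA; rewrite mxE.
  by rewrite (negPf iA) mulr0 addr0 y0//; apply: contra iA; exact: GA.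
rewrite iA mulr1 ltr_wpDl//; have [iG|iG] := boolP (i \in G); last by rewrite y0.
by rewrite ltW// yG.
Unshelve. all: by end_near. Qed.

Lemma closure_orthant_sub A G :
  @orthant R M G `<=` closure (@orthant R M A) -> G \subset A.
Proof.
move=> GA; apply/fintype.subsetP => i iG; apply: contraT => iA.
pose y : 'rV[R]_M := \row_k (k \in G)%:R.
(* The indicator of [G] has a neighbourhood on which coordinate [i] is nonzero, and this
   neighbourhood misses the orthant of [A]. *)
have yG : orthant G y by split=> k kG; rewrite mxE ?kG// (negPf kG).
have nb : nbhs y [set z : 'rV[R]_M | z 0 i != 0].
  apply: (@coord_continuous R 1 M 0 i y [set t : R | t != 0]).
  apply: open_nbhs_nbhs; split; first exact: open_neq.
  by rewrite /= mxE iG oner_eq0.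
have [z [[zA _] zi]] := GA y yG _ nb.
by case/negP: zi; rewrite zA.
Qed.

Definition pair_compatible (X : set 'rV[R]_M) : rel 'I_M :=
  fun i j => `[< orthant [set i; j]%SET `<=` X >].

Lemma pair_compatible_sym X : symmetric (pair_compatible X).
Proof. by move=> i j; rewrite /pair_compatible finset.setUC. Qed.

(** Closedness under faces makes the support of a point a clique. Conversely the flag condition puts
    the orthant of a clique in [X], since its two-element faces are the orthants of compatible
    pairs. *)
Lemma orthant_space_clique m X :
  orthant_space m X -> X = clique_space (pair_compatible X).
Proof.
move=> [[C XC] _ faces flag]; apply/seteqP; split=> y.
  move=> Xy; have : (\bigcup_(A in [set` C]) orthant A) y by rewrite -XC.
  move=> [A AC [yA ypos]]; have AX : orthant A `<=` X.
    by rewrite [X in _ `<=` X]XC => z zA; exists A.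
  have mem i : y 0 i != 0 -> i \in A by apply: contraR => iA; rewrite yA.
  split=> [i|i j /mem iA /mem jA].
    have [iA|iA] := boolP (i \in A); first by rewrite ltW// ypos.
    by rewrite yA.
  apply/asboolP; apply: faces AX _; apply: orthant_closure.
  by apply/fintype.subsetP => k; rewrite !inE => /orP[/eqP->|/eqP->].
move=> [y0 yc]; pose S := [set i | y 0 i != 0]%SET.
have yS : orthant S y.
  split=> i; first by rewrite inE negbK => /eqP.
  by rewrite inE lt0r y0 andbT.
apply: (flag S _ y yS) => G G2 /closure_orthant_sub GS.
have /cards2P[i [j [ij Gij]]] : #|G| == 2%N by apply/eqP.
move: GS; rewrite Gij => /fintype.subsetP sub.
apply/asboolP; apply: yc.
  by have := sub i; rewrite !inE eqxx => /(_ isT).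
by have := sub j; rewrite !inE eqxx orbT => /(_ isT).
Qed.

End OrthantSpace.

Unset Implicit Arguments.

Theorem proposition6 (R : realType) (M m l l' : nat) (X : set 'rV[R]_M)
    (E F : {set 'I_M}) (x xs w v : 'rV[R]_M) :
  orthant_space m X ->
  [disjoint E & F]%B ->
  orthant E `<=` X ->
  orthant (E :|: F) `<=` X ->
  codim m E = l ->
  codim m (E :|: F) = l' ->
  (2 <= l)%N ->
  (l' < l - 1)%N ->
  X x ->
  X xs ->
  orthant E xs ->
  link_sphere F w ->
  link_tangent F w v ->
  let Psi_tau := fun w' : 'rV[R]_M => Psi_stratum X E F x w' xs in
  arc_derivable Psi_tau w v /\ dot w (arc_derive Psi_tau w v) = 0.
Proof.
move=> oX EF0 _ EFX _ _ _ _ Xx _ xsE [wF _] [vF _].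
have XE := orthant_space_clique oX.
have cs := pair_compatible_sym X.
move: EFX Xx cs; set cmp := pair_compatible X; rewrite {}XE -/cmp => EFX Xx cs /=.
have [D cvgD0 wD] := arc_derive_Psi cs EF0 EFX Xx xsE wF vF.
split; first by apply: cvgP cvgD0.
by rewrite /arc_derive (cvg_lim _ cvgD0)//; exact: norm_hausdorff.
Qed.
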